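(* Let $0<q<1$. Let $R:=\bigoplus_{N\ge0}H^0(\mathcal L_N,\nabla_N^{\bar\partial})$ be the quantum homogeneous coordinate ring of $\mathbb CP^2_q$, with product induced by the bimodule tensor product $\mathcal L_{N_1}\otimes_{\mathcal A(\mathbb CP^2_q)}\mathcal L_{N_2}\simeq\mathcal L_{N_1+N_2}$. Then there is an algebra isomorphism $$R\simeq\frac{\mathbb C\langle z_1,z_2,z_3\rangle}{\langle\, z_iz_j-qz_jz_i:\ 1\le i<j\le3\,\rangle}.$$
   Context: Fix $0<q<1$; $[z]=\frac{q^z-q^{-z}}{q-q^{-1}}$, $[n]!=[1][2]\cdots[n]$, $[j,k,l]!=q^{-(jk+kl+lj)}\frac{[j+k+l]!}{[j]!\,[k]!\,[l]!}$. $U_q(\mathfrak{su}(3))$ is the Hopf $*$-algebra generated by $K_i^{\pm1},E_i,F_i$ ($i=1,2$), $K_i^*=K_i$, $E_i^*=F_i$, with $[K_1,K_2]=0$, $K_iE_i=qE_iK_i$, $[E_i,F_i]=\frac{K_i^2-K_i^{-2}}{q-q^{-1}}$, and for $i\ne j$: $K_iE_j=q^{-1/2}E_jK_i$, $[E_i,F_j]=0$, $E_i^2E_j+E_jE_i^2=(q+q^{-1})E_iE_jE_i$; $\Delta(K_i)=K_i\otimes K_i$, $\Delta(E_i)=E_i\otimes K_i+K_i^{-1}\otimes E_i$, $\Delta(F_i)=F_i\otimes K_i+K_i^{-1}\otimes F_i$; $\epsilon(K_i)=1$, $\epsilon(E_i)=\epsilon(F_i)=0$; $S(K_i)=K_i^{-1}$,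 $S(E_i)=-qE_i$, $S(F_i)=-q^{-1}F_i$. $\mathcal A(SU_q(3))$ is the $*$-algebra generated by $u^i_j$ ($i,j=1,2,3$) with $u^i_ku^j_k=qu^j_ku^i_k$ and $u^k_iu^k_j=qu^k_ju^k_i$ for $i<j$; $[u^i_l,u^j_k]=0$ and $[u^i_k,u^j_l]=(q-q^{-1})u^i_lu^j_k$ for $i<j$, $k<l$; $\sum_{\pi\in S_3}(-q)^{\ell(\pi)}u^1_{\pi(1)}u^2_{\pi(2)}u^3_{\pi(3)}=1$; and $(u^i_j)^*=(-q)^{j-i}(u^{k_1}_{l_1}u^{k_2}_{l_2}-qu^{k_1}_{l_2}u^{k_2}_{l_1})$, where $\{k_1<k_2\}=\{1,2,3\}\setminus\{i\}$, $\{l_1<l_2\}=\{1,2,3\}\setminus\{j\}$. It carries a right action of $U_q(\mathfrak{su}(3))$ with $(ab)\triangleleft h=(a\triangleleft h_{(1)})(b\triangleleft h_{(2)})$, $1\triangleleft h=\epsilon(h)1$, $(a\triangleleft h)^*=a^*\triangleleft S(h)^*$, and $u^j_k\triangleleft K_i=q^{\frac12(\delta_{i+1,j}-\delta_{i,j})}u^j_k$, $u^j_k\triangleleft E_i=\delta_{i+1,j}u^i_k$, $u^j_k\triangleleft F_i=\delta_{i,j}u^{i+1}_k$. Let $U_q(\mathfrak{su}(2))$ be the subalgebra generated by $K_1^{\pm1},E_1,F_1$. Put $\mathcal A(S^5_q)=\{a\in\mathcal A(SU_q(3)): a\triangleleft h=\epsilon(h)a\ \forall h\in U_q(\mathfrak{su}(2))\}$,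 generated as a $*$-algebra by $z_j=u^3_j$; for $N\in\mathbb Z$, $\mathcal L_N=\{a\in\mathcal A(S^5_q): a\triangleleft K_1K_2^2=q^Na\}$; and $\mathcal A(\mathbb CP^2_q)=\mathcal L_0$. Each $\mathcal L_N$ is an $\mathcal A(\mathbb CP^2_q)$-bimodule by multiplication, and multiplication in $\mathcal A(S^5_q)$ induces $\mathcal L_{N}\otimes_{\mathcal A(\mathbb CP^2_q)}\mathcal L_{M}\simeq\mathcal L_{N+M}$; this is the product used on $R$ (it maps holomorphic sections to holomorphic sections). $\Omega^{(0,1)}$ is the set of pairs $(v_+,v_-)^t\in\mathcal A(SU_q(3))^2$ such that (componentwise action) $(v_+,v_-)\triangleleft K_1K_2^2=q^{3/2}(v_+,v_-)$, $(v_+,v_-)\triangleleft K_1=(q^{1/2}v_+,q^{-1/2}v_-)$, $(v_+,v_-)\triangleleft F_1=(0,v_+)$, $(v_+,v_-)\triangleleft E_1=(v_-,0)$; it is an $\mathcal A(\mathbb CP^2_q)$-bimodule by componentwise multiplication. $\bar\partial:\mathcal A(\mathbb CP^2_q)\to\Omega^{(0,1)}$ is $\bar\partial a=(a\triangleleft F_2F_1,\ a\triangleleft F_2)^t$. For $N\ge0$, $\Psi_N$ is the column vector with components $\psi^N_{j,k,l}$ ($j,k,l\ge0$, $j+k+l=N$), $(\psi^N_{j,k,l})^*=\sqrt{[j,k,l]!}\,z_1^jz_2^kz_3^l$; then $\Psi_N^\dagger\Psi_N=1$. For $\xi\in\mathcal L_N$ the entries of $\Psi_N\xi$ are in $\mathcal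 A(\mathbb CP^2_q)$. The multiplication map $\Omega^{(0,1)}\otimes_{\mathcal A(\mathbb CP^2_q)}\mathcal L_N\to\mathcal A(SU_q(3))^2$, $(v_+,v_-)^t\otimes\xi\mapsto(v_+\xi,v_-\xi)^t$, is injective and identifies $\Omega^{(0,1)}\otimes\mathcal L_N$ with its image. The $\bar\partial$-connection is $\nabla_N^{\bar\partial}:\mathcal L_N\to\Omega^{(0,1)}\otimes_{\mathcal A(\mathbb CP^2_q)}\mathcal L_N$, $\nabla_N^{\bar\partial}\xi=q^{-N}\Psi_N^\dagger\,\bar\partial(\Psi_N\xi)=q^{-N}\Psi_N^\dagger\big((\Psi_N\xi)\triangleleft F_2F_1,\ (\Psi_N\xi)\triangleleft F_2\big)^t$, and $H^0(\mathcal L_N,\nabla_N^{\bar\partial})=\ker\nabla_N^{\bar\partial}\subset\mathcal L_N$ is the space of holomorphic sections. *)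

(* Defs.v *)
From HB Require Import structures.
From mathcomp Require Import all_boot all_order all_algebra perm.
From mathcomp Require Import boolp reals complex.

Set Implicit Arguments.
Unset Strict Implicit.
Unset Printing Implicit Defensive.

Import Order.TTheory GRing.Theory Num.Theory.
Local Open Scope ring_scope.
Local Open Scope quotient_scope.

(******************************************************************************)
(* Associative unital K-algebras given by generators X and relations rel.     *)
(* An expr is a formal noncommutative polynomial expression in the generators. *)
(* tcong rel is the least congruence on exprs that contains the axioms of     *)
(* associative unital K-algebras and rel, so that palg rel is                 *)
(* K<X> / (s - t : rel s t); lemma palg_universal is its universal property.  *)
(******************************************************************************)

Inductive expr (K X : Type) : Type :=
| Var of X
| Cst of K
| Add of expr K X & expr K X
| Mul of expr K X & expr K X.
Arguments Var {K X} _.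
Arguments Cst {K X} _.

Declare Scope expr_scope.
Delimit Scope expr_scope with expr.
Bind Scope expr_scope with expr.
Notation "s + t" := (Add s t) : expr_scope.
Notation "s * t" := (Mul s t) : expr_scope.
Notation "c *: t" := (Mul (Cst c%R) t) : expr_scope.
Notation "s - t" := (Add s (Mul (Cst (-1)%R) t)) : expr_scope.
Notation "1" := (Cst 1%R) : expr_scope.

HB.instance Definition _ (K X : Type) := gen_eqMixin (expr K X).
HB.instance Definition _ (K X : Type) := gen_choiceMixin (expr K X).

Section Presentation.
Variables (K : fieldType) (X : Type) (rel : expr K X -> expr K X -> Prop).

Inductive tcong : expr K X -> expr K X -> Prop :=
| tc_refl s : tcong s s
| tc_sym s t : tcong s t -> tcong t s
| tc_trans s t r : tcong s t -> tcong t r -> tcong s r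
| tc_add s s' t t' :
    tcong s s' -> tcong t t' -> tcong (s + t)%expr (s' + t')%expr
| tc_mul s s' t t' :
    tcong s s' -> tcong t t' -> tcong (s * t)%expr (s' * t')%expr
| tc_addA s t r : tcong (s + (t + r))%expr (s + t + r)%expr
| tc_addC s t : tcong (s + t)%expr (t + s)%expr
| tc_add0 s : tcong (Cst 0 + s)%expr s
| tc_mulA s t r : tcong (s * (t * r))%expr (s * t * r)%expr
| tc_mul1l s : tcong (1 * s)%expr s
| tc_mul1r s : tcong (s * 1)%expr s
| tc_mul0l s : tcong (Cst 0 * s)%expr (Cst 0)
| tc_mulDl s t r : tcong ((s + t) * r)%expr (s * r + t * r)%expr
| tc_mulDr s t r : tcong (s * (t + r))%expr (s * t + s * r)%expr
| tc_cstD c d : tcong (Cst (c + d)) (Cst c + Cst d)%expr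
| tc_cstM c d : tcong (Cst (c * d)) (Cst c * Cst d)%expr
| tc_cstC c s : tcong (Cst c * s)%expr (s * Cst c)%expr
| tc_rel s t : rel s t -> tcong s t.

Definition tcongb (s t : expr K X) : bool := `[< tcong s t >].

Lemma tcongb_equiv : equiv_class_of tcongb.
Proof.
split=> [s|s t|t s r].
- exact/asboolP/tc_refl.
- by apply/asboolP/asboolP; apply: tc_sym.
- by move=> /asboolP st /asboolP tr; apply/asboolP; apply: tc_trans tr.
Qed.

Canonical tcong_equiv := EquivRelPack tcongb_equiv.

Definition palg := {eq_quot tcong_equiv}.

HB.instance Definition _ := Choice.on palg.
HB.instance Definition _ := EqQuotient.on palg.

Definition pcls (t : expr K X) : palg := \pi_palg t.
Definition pgen (x : X) : palg := pcls (Var x).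

Lemma pclsP s t : pcls s = pcls t <-> tcong s t.
Proof.
by split=> [/eqquotP/asboolP //|st]; apply/eqquotP/asboolP.
Qed.

Lemma pclsK (x : palg) : pcls (repr x) = x.
Proof. exact: reprK. Qed.

Lemma repr_pcls t : tcong (repr (pcls t)) t.
Proof. by apply/pclsP; rewrite pclsK. Qed.

Lemma palg_ind (P : palg -> Prop) :
  (forall t, P (pcls t)) -> forall x, P x.
Proof. by move=> Pt x; rewrite -(pclsK x). Qed.

Definition padd (x y : palg) : palg := pcls (repr x + repr y)%expr.
Definition pmul (x y : palg) : palg := pcls (repr x * repr y)%expr.
Definition pscale (c : K) (x : palg) : palg := pcls (c *: repr x)%expr.
Definition popp (x : palg) : palg := pscale (-1) x.

Lemma padd_pcls s t : padd (pcls s) (pcls t) = pcls (s + t)%expr.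
Proof. by apply/pclsP; apply: tc_add; apply: repr_pcls. Qed.

Lemma pmul_pcls s t : pmul (pcls s) (pcls t) = pcls (s * t)%expr.
Proof. by apply/pclsP; apply: tc_mul; apply: repr_pcls. Qed.

Lemma pscale_pcls c t : pscale c (pcls t) = pcls (c *: t)%expr.
Proof. by apply/pclsP; apply: tc_mul (tc_refl _) (repr_pcls _). Qed.

Fact paddA : associative padd.
Proof.
elim/palg_ind=> s; elim/palg_ind=> t; elim/palg_ind=> r.
by rewrite !padd_pcls; apply/pclsP/tc_addA.
Qed.

Fact paddC : commutative padd.
Proof.
elim/palg_ind=> s; elim/palg_ind=> t.
by rewrite !padd_pcls; apply/pclsP/tc_addC.
Qed.

Fact padd0 : left_id (pcls (Cst 0)) padd.
Proof. by elim/palg_ind=> s; rewrite padd_pcls; apply/pclsP/tc_add0. Qed.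

Fact paddN : left_inverse (pcls (Cst 0)) popp padd.
Proof.
elim/palg_ind=> s; rewrite /popp pscale_pcls padd_pcls; apply/pclsP.
apply: tc_trans (tc_add (tc_refl _) (tc_sym (tc_mul1l s))) _.
apply: tc_trans (tc_sym (tc_mulDl _ _ _)) _.
apply: tc_trans (tc_mul (tc_sym (tc_cstD _ _)) (tc_refl _)) _.
by rewrite addNr; apply: tc_mul0l.
Qed.

HB.instance Definition _ :=
  GRing.isZmodule.Build palg paddA paddC padd0 paddN.

Fact pmulA : associative pmul.
Proof.
elim/palg_ind=> s; elim/palg_ind=> t; elim/palg_ind=> r.
by rewrite !pmul_pcls; apply/pclsP/tc_mulA.
Qed.

Fact pmul1l : left_id (pcls 1%expr) pmul.
Proof. by elim/palg_ind=> s; rewrite pmul_pcls; apply/pclsP/tc_mul1l. Qed.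

Fact pmul1r : right_id (pcls 1%expr) pmul.
Proof. by elim/palg_ind=> s; rewrite pmul_pcls; apply/pclsP/tc_mul1r. Qed.

Fact pmulDl : left_distributive pmul padd.
Proof.
elim/palg_ind=> s; elim/palg_ind=> t; elim/palg_ind=> r.
by rewrite padd_pcls !pmul_pcls padd_pcls; apply/pclsP/tc_mulDl.
Qed.

Fact pmulDr : right_distributive pmul padd.
Proof.
elim/palg_ind=> s; elim/palg_ind=> t; elim/palg_ind=> r.
by rewrite padd_pcls !pmul_pcls padd_pcls; apply/pclsP/tc_mulDr.
Qed.

HB.instance Definition _ :=
  GRing.Zmodule_isPzRing.Build palg pmulA pmul1l pmul1r pmulDl pmulDr.

Fact pscaleA c d x : pscale c (pscale d x) = pscale (c * d) x.
Proof.
elim/palg_ind: x => s; rewrite !pscale_pcls; apply/pclsP.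
apply: tc_trans (tc_mulA _ _ _) _.
exact: tc_mul (tc_sym (tc_cstM _ _)) (tc_refl _).
Qed.

Fact pscale1 : left_id 1 pscale.
Proof. by elim/palg_ind=> s; rewrite pscale_pcls; apply/pclsP/tc_mul1l. Qed.

Fact pscaleDr : right_distributive pscale +%R.
Proof.
move=> c; elim/palg_ind=> s; elim/palg_ind=> t.
rewrite /GRing.add /= padd_pcls !pscale_pcls padd_pcls.
exact/pclsP/tc_mulDr.
Qed.

Fact pscaleDl x : {morph pscale^~ x : c d / c + d}.
Proof.
elim/palg_ind: x => s c d /=.
rewrite !pscale_pcls [RHS]padd_pcls; apply/pclsP.
apply: tc_trans (tc_mul (tc_cstD _ _) (tc_refl _)) _; exact: tc_mulDl.
Qed.

HB.instance Definition _ := GRing.Zmodule_isLmodule.Build K palg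
  pscaleA pscale1 pscaleDr pscaleDl.

Lemma pclsD s t : pcls (s + t)%expr = pcls s + pcls t.
Proof. by rewrite [RHS]padd_pcls. Qed.

Lemma pclsM s t : pcls (s * t)%expr = pcls s * pcls t.
Proof. by rewrite [RHS]pmul_pcls. Qed.

Lemma pclsZ c t : pcls (c *: t)%expr = c *: pcls t.
Proof. by rewrite [RHS]pscale_pcls. Qed.

Lemma pcls1 : pcls 1%expr = 1.
Proof. by []. Qed.

Lemma pcls_cst c : pcls (Cst c) = c *: (1 : palg).
Proof. by rewrite -pcls1 -pclsZ; apply/pclsP/tc_sym/tc_mul1r. Qed.

Lemma palg_scaleAl c (x y : palg) : c *: (x * y) = (c *: x) * y.
Proof.
elim/palg_ind: x => s; elim/palg_ind: y => t.
rewrite -pclsM -!pclsZ -pclsM; exact/pclsP/tc_mulA.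
Qed.

Lemma palg_scaleAr c (x y : palg) : c *: (x * y) = x * (c *: y).
Proof.
elim/palg_ind: x => s; elim/palg_ind: y => t.
rewrite -pclsM -!pclsZ -pclsM; apply/pclsP.
apply: tc_trans (tc_mulA _ _ _) _.
apply: tc_trans (tc_mul (tc_cstC _ _) (tc_refl _)) _.
exact: tc_sym (tc_mulA _ _ _).
Qed.

Section Evaluation.
Variables (B : algType K) (f : X -> B).

Fixpoint teval (t : expr K X) : B :=
  match t with
  | Var x => f x
  | Cst c => c%:A
  | Add s t => teval s + teval t
  | Mul s t => teval s * teval t
  end.

Hypothesis f_rel : forall s t, rel s t -> teval s = teval t.

Lemma teval_tcong s t : tcong s t -> teval s = teval t.
Proof.
elim=> {s t} //=.
- by move=> s t r _ -> _ ->.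
- by move=> s s' t t' _ -> _ ->.
- by move=> s s' t t' _ -> _ ->.
- by move=> *; rewrite addrA.
- by move=> *; rewrite addrC.
- by move=> *; rewrite scale0r add0r.
- by move=> *; rewrite mulrA.
- by move=> *; rewrite scale1r mul1r.
- by move=> *; rewrite scale1r mulr1.
- by move=> *; rewrite scale0r mul0r.
- by move=> *; rewrite mulrDl.
- by move=> *; rewrite mulrDr.
- by move=> *; rewrite scalerDl.
- by move=> c d; rewrite -scalerAl mul1r scalerA.
- by move=> c s; rewrite mulr_algl mulr_algr.
Qed.

Lemma palg_universal :
  (exists phi : {rmorphism palg -> B},
     (forall c x, phi (c *: x) = c *: phi x) /\ forall x, phi (pgen x) = f x) /\
  (forall phi psi : {rmorphism palg -> B},
     (forall c x, phi (c *: x) = c *: phi x) ->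
     (forall c x, psi (c *: x) = c *: psi x) ->
     (forall x, phi (pgen x) = psi (pgen x)) -> phi =1 psi).
Proof.
split=> [|phi psi phiZ psiZ eq_gen]; last first.
  elim/palg_ind; elim=> [x|c|s IHs t IHt|s IHs t IHt]; first exact: eq_gen.
  - by rewrite pcls_cst phiZ psiZ !rmorph1.
  - by rewrite pclsD !rmorphD IHs IHt.
  - by rewrite pclsM !rmorphM IHs IHt.
pose phi (x : palg) := teval (repr x).
have phiE t : phi (pcls t) = teval t by apply/teval_tcong/repr_pcls.
have phiB : {morph phi : x y / x - y}.
  elim/palg_ind=> s; elim/palg_ind=> t.
  by rewrite -[- _]scaleN1r -pclsZ -pclsD !phiE /= mulr_algl scaleN1r.
have phiM : {morph phi : x y / x * y}.
  by elim/palg_ind=> s; elim/palg_ind=> t; rewrite -pclsM !phiE.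
have phi1 : phi 1 = 1 by rewrite -pcls1 phiE /= scale1r.
pose phia := GRing.isZmodMorphism.Build _ _ phi phiB.
pose phim := GRing.isMonoidMorphism.Build _ _ phi (phi1, phiM).
pose phir : {rmorphism palg -> B} := HB.pack phi phia phim.
exists phir; split=> [c|x]; last by rewrite /= phiE.
by elim/palg_ind=> t /=; rewrite -pclsZ !phiE /= mulr_algl.
Qed.

Lemma palg_oner_neq0 : (1 : palg) != 0.
Proof.
apply/eqP => /pclsP/teval_tcong /= /eqP.
by rewrite scale1r scale0r oner_eq0.
Qed.

End Evaluation.

End Presentation.

Arguments pcls {K X} rel t.
Arguments pgen {K X} rel x.

(******************************************************************************)
(* Complex *-algebras given by generators and relations: sg is the involution *)
(* on generators, and the set of relations is closed under the induced star.  *)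
(******************************************************************************)

Section StarPresentation.
Variables (R : realType) (X : Type) (sg : X -> X).

Fixpoint tstar (t : expr R[i] X) : expr R[i] X :=
  match t with
  | Var x => Var (sg x)
  | Cst c => Cst (Num.conj c)
  | Add s t => Add (tstar s) (tstar t)
  | Mul s t => Mul (tstar t) (tstar s)
  end.

Variable rel : expr R[i] X -> expr R[i] X -> Prop.

Inductive star_rel : expr R[i] X -> expr R[i] X -> Prop :=
| star_rel_base s t : rel s t -> star_rel s t
| star_rel_star s t : rel s t -> star_rel (tstar s) (tstar t).

Definition pstar (a : palg star_rel) : palg star_rel :=
  pcls star_rel (tstar (repr a)).

Hypothesis sgK : involutive sg.

Lemma tstarK : involutive tstar.
Proof. by elim=> /= [x|c|s -> t ->|s -> t ->] //; rewrite ?sgK ?conjCK. Qed.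

Lemma tcong_star s t :
  tcong star_rel s t -> tcong star_rel (tstar s) (tstar t).
Proof.
elim=> {s t} /=.
- by move=> s; apply: tc_refl.
- by move=> s t _; apply: tc_sym.
- by move=> s t r _ st _; apply: tc_trans st.
- by move=> s s' t t' _ ss _ tt; apply: tc_add.
- by move=> s s' t t' _ ss _ tt; apply: tc_mul.
- by move=> *; apply: tc_addA.
- by move=> *; apply: tc_addC.
- by move=> *; rewrite conjC0; apply: tc_add0.
- by move=> *; apply/tc_sym/tc_mulA.
- by move=> s; rewrite conjC1; apply: tc_mul1r.
- by move=> s; rewrite conjC1; apply: tc_mul1l.
- move=> s; rewrite conjC0.
  exact: tc_trans (tc_sym (tc_cstC _ _ _)) (tc_mul0l _ _).
- by move=> *; apply: tc_mulDr.
- by move=> *; apply: tc_mulDl.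
- by move=> c d; rewrite rmorphD; apply: tc_cstD.
- by move=> c d; rewrite mulrC rmorphM; apply: tc_cstM.
- by move=> c s; apply/tc_sym/tc_cstC.
- move=> s t [{}s {}t st|{}s {}t st]; apply: tc_rel.
    exact: star_rel_star.
  by rewrite !tstarK; apply: star_rel_base.
Qed.

Lemma pstar_pcls t : pstar (pcls star_rel t) = pcls star_rel (tstar t).
Proof. by apply/pclsP/tcong_star/repr_pcls. Qed.

(* A *-compatible scalar evaluation only has to be checked on rel. *)
Lemma star_rel_teval (f : X -> R[i]^o) :
  (forall x, f (sg x) = Num.conj (f x)) ->
  (forall s t, rel s t -> teval f s = teval f t) ->
  forall s t, star_rel s t -> teval f s = teval f t.
Proof.
move=> fsg frel.
have fstar t : teval f (tstar t) = Num.conj (teval f t).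
  elim: t => /= [x|c|s IHs t IHt|s IHs t IHt].
  - exact: fsg.
  - by rewrite /GRing.scale /= !mulr1.
  - by rewrite IHs IHt rmorphD.
  - by rewrite IHs IHt mulrC rmorphM.
by move=> s t [{}s {}t /frel //|{}s {}t /frel st]; rewrite !fstar st.
Qed.

End StarPresentation.

Arguments pstar {R X sg rel} a.

(******************************************************************************)
(* U_q(su(3)).  The indices i = 1, 2 of the generators are 0, 1 : 'I_2.       *)
(******************************************************************************)

Inductive Ugen :=
| UK of 'I_2
| UKinv of 'I_2
| UE of 'I_2
| UF of 'I_2.

Definition Ugen_idx (g : Ugen) : 'I_2 :=
  match g with UK i | UKinv i | UE i | UF i => i end.

Definition Ustar_gen (g : Ugen) : Ugen :=
  match g with
  | UK i => UK i
  | UKinv i => UKinv i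
  | UE i => UF i
  | UF i => UE i
  end.

Section Uqsu3.
Variables (R : realType) (q : R).
Local Open Scope complex_scope.
Local Notation C := R[i].
Local Notation Uterm := (expr C Ugen).
Local Notation tK i := (Var (UK i) : Uterm).
Local Notation tKi i := (Var (UKinv i) : Uterm).
Local Notation tE i := (Var (UE i) : Uterm).
Local Notation tF i := (Var (UF i) : Uterm).

(* The relations between K_i and F_j and the Serre relation for the F_i are   *)
(* the images under * of those below.                                         *)
Inductive Uq_rel : Uterm -> Uterm -> Prop :=
| Uq_KKinv i : Uq_rel (tK i * tKi i)%expr 1%expr
| Uq_KinvK i : Uq_rel (tKi i * tK i)%expr 1%expr
| Uq_KK i j : Uq_rel (tK i * tK j)%expr (tK j * tK i)%expr
| Uq_KE i : Uq_rel (tK i * tE i)%expr (q%:C *: (tE i * tK i))%expr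
| Uq_EF i :
    Uq_rel (tE i * tF i - tF i * tE i)%expr
           ((q%:C - q%:C^-1)^-1 *: (tK i * tK i - tKi i * tKi i))%expr
| Uq_KE' (i j : 'I_2) : i != j ->
    Uq_rel (tK i * tE j)%expr (((Num.sqrt q)%:C)^-1 *: (tE j * tK i))%expr
| Uq_EF' (i j : 'I_2) : i != j -> Uq_rel (tE i * tF j)%expr (tF j * tE i)%expr
| Uq_Serre (i j : 'I_2) : i != j ->
    Uq_rel (tE i * tE i * tE j + tE j * tE i * tE i)%expr
           ((q%:C + q%:C^-1) *: (tE i * tE j * tE i))%expr.

Definition Uqsu3 : Type := palg (star_rel Ustar_gen Uq_rel).

Definition Ucls (t : Uterm) : Uqsu3 := pcls _ t.

(* Counit, antipode and coproduct, computed on expressions t for an element   *)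
(* of U_q(su(3)).  Ucoprod t is the list of the pairs (h_(1), h_(2)) of a     *)
(* Sweedler decomposition of the coproduct of h = Ucls t.                     *)
Definition Ucounit : Uterm -> C^o :=
  teval (fun g : Ugen => match g with
                         | UK _ | UKinv _ => 1
                         | UE _ | UF _ => 0
                         end : C^o).

Fixpoint Uantipode (t : Uterm) : Uterm :=
  match t with
  | Var (UK i) => tKi i
  | Var (UKinv i) => tK i
  | Var (UE i) => (- q%:C *: tE i)%expr
  | Var (UF i) => (- q%:C^-1 *: tF i)%expr
  | Cst c => Cst c
  | Add s t => Add (Uantipode s) (Uantipode t)
  | Mul s t => Mul (Uantipode t) (Uantipode s)
  end.

Fixpoint Ucoprod (t : Uterm) : seq (Uterm * Uterm) :=
  match t with
  | Var (UK i) => [:: (tK i, tK i)]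
  | Var (UKinv i) => [:: (tKi i, tKi i)]
  | Var (UE i) => [:: (tE i, tK i); (tKi i, tE i)]
  | Var (UF i) => [:: (tF i, tK i); (tKi i, tF i)]
  | Cst c => [:: (Cst c, 1%expr)]
  | Add s t => Ucoprod s ++ Ucoprod t
  | Mul s t => [seq ((x.1 * y.1)%expr, (x.2 * y.2)%expr) |
                 x <- Ucoprod s, y <- Ucoprod t]
  end.

(* Expressions in K_1, K_1^-1, E_1, F_1 only: their classes form U_q(su(2)). *)
Fixpoint in_su2 (t : Uterm) : bool :=
  match t with
  | Var g => Ugen_idx g == ord0
  | Cst _ => true
  | Add s t | Mul s t => in_su2 s && in_su2 t
  end.

Fact Uq_rel_counit s t : star_rel Ustar_gen Uq_rel s t ->
  Ucounit s = Ucounit t.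
Proof.
apply: star_rel_teval; first by case=> i /=; rewrite ?conjC0 ?conjC1.
rewrite /Ucounit => {}s {}t [] //= *; rewrite ?(mulr0, mul0r, mulr1, addr0) //.
by rewrite scaleN1r subrr mulr0.
Qed.

HB.instance Definition _ := GRing.PzRing.on Uqsu3.
HB.instance Definition _ := GRing.Lmodule.on Uqsu3.
HB.instance Definition _ := GRing.PzSemiRing_isNonZero.Build Uqsu3
  (palg_oner_neq0 Uq_rel_counit).
HB.instance Definition _ := GRing.Lmodule_isLalgebra.Build C Uqsu3
  (@palg_scaleAl _ _ _).
HB.instance Definition _ := GRing.Lalgebra_isAlgebra.Build C Uqsu3
  (@palg_scaleAr _ _ _).

End Uqsu3.

(******************************************************************************)
(* A(SU_q(3)).  The indices 1, 2, 3 are 0, 1, 2 : 'I_3; Au i j stands for     *)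
(* u^i_j and Austar i j for its adjoint.                                      *)
(******************************************************************************)

Inductive Agen :=
| Au of 'I_3 & 'I_3
| Austar of 'I_3 & 'I_3.

Definition Astar_gen (g : Agen) : Agen :=
  match g with
  | Au i j => Austar i j
  | Austar i j => Au i j
  end.

Definition perm_length n (s : 'S_n) : nat :=
  #|[set p : 'I_n * 'I_n | (p.1 < p.2)%N && (s p.2 < s p.1)%N]|.

Section SUq3.
Variables (R : realType) (q : R).
Local Open Scope complex_scope.
Local Notation C := R[i].
Local Notation Aterm := (expr C Agen).
Local Notation u i j := (Var (Au i j) : Aterm).
Local Notation i1 := (inord 0 : 'I_3).
Local Notation i2 := (inord 1 : 'I_3).
Local Notation i3 := (inord 2 : 'I_3).

Inductive Aq_rel : Aterm -> Aterm -> Prop :=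
| Aq_col (i j k : 'I_3) : (i < j)%N ->
    Aq_rel (u i k * u j k)%expr (q%:C *: (u j k * u i k))%expr
| Aq_row (i j k : 'I_3) : (i < j)%N ->
    Aq_rel (u k i * u k j)%expr (q%:C *: (u k j * u k i))%expr
| Aq_comm (i j k l : 'I_3) : (i < j)%N -> (k < l)%N ->
    Aq_rel (u i l * u j k)%expr (u j k * u i l)%expr
| Aq_cross (i j k l : 'I_3) : (i < j)%N -> (k < l)%N ->
    Aq_rel (u i k * u j l - u j l * u i k)%expr
           ((q%:C - q%:C^-1) *: (u i l * u j k))%expr
| Aq_det :
    Aq_rel (\big[@Add C Agen/Cst 0]_(s : 'S_3)
              ((- q%:C) ^+ perm_length s *:
                 (u i1 (s i1) * u i2 (s i2) * u i3 (s i3))))%expr 1%expr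
| Aq_star (i j k1 k2 l1 l2 : 'I_3) :
    (k1 < k2)%N -> k1 != i -> k2 != i -> (l1 < l2)%N -> l1 != j -> l2 != j ->
    Aq_rel (Var (Austar i j))
           ((- q%:C) ^ (j%:Z - i%:Z) *:
              (u k1 l1 * u k2 l2 - q%:C *: (u k1 l2 * u k2 l1)))%expr.

Definition SUq3 : Type := palg (star_rel Astar_gen Aq_rel).

(* The character u^i_j |-> delta_ij shows that A(SU_q(3)) is not zero. *)
Definition Acounit : Aterm -> C^o :=
  teval (fun g : Agen => match g with
                         | Au i j | Austar i j => (i == j)%:R
                         end : C^o).

Fact Aq_rel_counit s t : star_rel Astar_gen Aq_rel s t ->
  Acounit s = Acounit t.
Proof.
have delta0 (i j k l : 'I_3) : (i = j -> k = l -> False) ->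
    (i == j)%:R * (k == l)%:R = 0 :> C^o.
  move=> H; case: eqP => [ij|_]; last by rewrite mul0r.
  by case: eqP => [kl|_]; [case: (H ij kl) | rewrite mulr0].
apply: star_rel_teval; first by case=> i j /=; rewrite conjC_nat.
rewrite /Acounit => {}s {}t [] //=.
- move=> i j k ltij; rewrite mulrC delta0 ?mulr0 //.
  by move=> jk ik; rewrite jk ik ltnn in ltij.
- move=> i j k ltij; rewrite mulrC delta0 ?mulr0 //.
  by move=> kj ki; rewrite -kj -ki ltnn in ltij.
- by move=> *; rewrite mulrC.
- move=> i j k l ltij ltkl; rewrite scaleN1r mulN1r mulrC subrr delta0 ?mulr0 //.
  by move=> il jk; rewrite il jk ltnNge ltnW in ltij.
- set ev := teval _; have evD : {morph ev : s t / Add s t >-> s + t} by [].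
  have ev0 : ev (Cst 0) = 0 by rewrite /ev /= scale0r.
  rewrite (big_morph ev evD ev0) (bigD1 (1%g : 'S_3)) //= big1 ?addr0.
    rewrite !perm1 !eqxx !mulr1 /perm_length.
    rewrite (_ : [set p | _] = set0) ?cards0 ?expr0 //.
    apply/setP=> p; rewrite !inE !perm1.
    by case: ltnP => //= p12; rewrite ltnNge ltnW.
  move=> p p1; case: eqP => [e1|_]; last by rewrite !(mul0r, mulr0).
  case: eqP => [e2|_]; last by rewrite !(mul0r, mulr0).
  case: eqP => [e3|_]; last by rewrite !(mul0r, mulr0).
  case/eqP: p1; apply/permP => i; rewrite perm1.
  have [->|->|->] // : [\/ i = i1, i = i2 | i = i3].
  case: i => [[|[|[|]]] hi] //; [constructor 1|constructor 2|constructor 3];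
    by apply: val_inj; rewrite /= inordK.
- move=> [[|[|[|?]]] ?] [[|[|[|?]]] ?] [[|[|[|?]]] ?] [[|[|[|?]]] ?] //=.
  all: move=> [[|[|[|?]]] ?] [[|[|[|?]]] ?] //= *.
  all: rewrite -?val_eqE /= ?(mulr0, mul0r, mulr1, addr0, scaler0, scale0r).
  all: by rewrite ?subrr ?expr0z ?scale1r.
Qed.

HB.instance Definition _ := GRing.PzRing.on SUq3.
HB.instance Definition _ := GRing.Lmodule.on SUq3.
HB.instance Definition _ := GRing.PzSemiRing_isNonZero.Build SUq3
  (palg_oner_neq0 Aq_rel_counit).
HB.instance Definition _ := GRing.Lmodule_isLalgebra.Build C SUq3
  (@palg_scaleAl _ _ _).
HB.instance Definition _ := GRing.Lalgebra_isAlgebra.Build C SUq3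
  (@palg_scaleAr _ _ _).

End SUq3.

(******************************************************************************)
(* C<z_1, z_2, z_3> / <z_i z_j - q z_j z_i : i < j>.                          *)
(******************************************************************************)

Section QuantumPlane.
Variables (R : realType) (q : R).
Local Open Scope complex_scope.
Local Notation C := R[i].
Local Notation z i := (Var i : expr C 'I_3).

Inductive qplane_rel : expr C 'I_3 -> expr C 'I_3 -> Prop :=
| qplane_comm (i j : 'I_3) : (i < j)%N ->
    qplane_rel (z i * z j)%expr (q%:C *: (z j * z i))%expr.

Definition qplane : Type := palg qplane_rel.

Fact qplane_rel0 s t : qplane_rel s t ->
  teval (fun=> 0 : C^o) s = teval (fun=> 0 : C^o) t.
Proof. by case=> i j _ /=; rewrite !mulr0. Qed.

HB.instance Definition _ := GRing.PzRing.on qplane.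
HB.instance Definition _ := GRing.Lmodule.on qplane.
HB.instance Definition _ := GRing.PzSemiRing_isNonZero.Build qplane
  (palg_oner_neq0 qplane_rel0).
HB.instance Definition _ := GRing.Lmodule_isLalgebra.Build C qplane
  (@palg_scaleAl _ _ _).
HB.instance Definition _ := GRing.Lalgebra_isAlgebra.Build C qplane
  (@palg_scaleAr _ _ _).

End QuantumPlane.

(******************************************************************************)
(* The right action of U_q(su(3)) on A(SU_q(3)).                              *)
(******************************************************************************)

Section Action.
Variables (R : realType) (q : R).
Local Open Scope complex_scope.
Local Notation C := R[i].
Local Notation A := (SUq3 q).
Local Notation U := (Uqsu3 q).

Definition Agen_u (i j : 'I_3) : A := pgen _ (Au i j).
Definition Ugen_K (i : 'I_2) : U := pgen _ (UK i).
Definition Ugen_E (i : 'I_2) : U := pgen _ (UE i).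
Definition Ugen_F (i : 'I_2) : U := pgen _ (UF i).

(* Rows i and i + 1 of the matrix u, for i = 1, 2. *)
Definition row_lo (i : 'I_2) : 'I_3 := widen_ord (leqnSn 2) i.
Definition row_hi (i : 'I_2) : 'I_3 := lift ord0 i.

(* act a h is a <| h. *)
Record su3_action (act : A -> U -> A) : Prop := Su3Action {
  act_linearl : forall h, linear (act^~ h);
  act_linearr : forall a, linear (act a);
  act_id : forall a, act a 1 = a;
  act_comp : forall a g h, act a (g * h) = act (act a g) h;
  act_mul : forall a b t,
    act (a * b) (Ucls q t) =
      \sum_(x <- Ucoprod t) act a (Ucls q x.1) * act b (Ucls q x.2);
  act_one : forall t, act 1 (Ucls q t) = Ucounit t *: 1;
  act_star : forall a t,
    pstar (act a (Ucls q t)) =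
      act (pstar a) (pstar (Ucls q (Uantipode q t)));
  act_K : forall i j k,
    act (Agen_u j k) (Ugen_K i) =
      (Num.sqrt q)%:C ^ ((j == row_hi i)%:Z - (j == row_lo i)%:Z) *: Agen_u j k;
  act_E : forall i j k,
    act (Agen_u j k) (Ugen_E i) = (j == row_hi i)%:R *: Agen_u (row_lo i) k;
  act_F : forall i j k,
    act (Agen_u j k) (Ugen_F i) = (j == row_lo i)%:R *: Agen_u (row_hi i) k
}.

Variable act : A -> U -> A.
Local Notation K1 := (Ugen_K ord0).
Local Notation K2 := (Ugen_K ord_max).
Local Notation F1 := (Ugen_F ord0).
Local Notation F2 := (Ugen_F ord_max).

(* A(S^5_q) *)
Definition in_S5 (a : A) : Prop :=
  forall t, in_su2 t -> act a (Ucls q t) = Ucounit t *: a.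

Definition line_bundle (N : int) (a : A) : Prop :=
  in_S5 a /\ act a (K1 * K2 ^+ 2) = q%:C ^ N *: a.

(* The components v_+ and v_- of dbar a, for a in A(CP^2_q) = L_0. *)
Definition dbar (a : A) : A * A := (act a (F2 * F1), act a F2).

Definition qnum (n : nat) : R := (q ^+ n - q ^- n) / (q - q^-1).
Definition qfact (n : nat) : R := \prod_(1 <= i < n.+1) qnum i.
Definition qtrinom (j k l : nat) : R :=
  q ^- (j * k + k * l + l * j) *
    (qfact (j + k + l) / (qfact j * qfact k * qfact l)).

Definition zcoord (j : 'I_3) : A := Agen_u ord_max j.

Definition psi (j k l : nat) : A :=
  pstar ((Num.sqrt (qtrinom j k l))%:C *:
    (zcoord (inord 0) ^+ j * zcoord (inord 1) ^+ k * zcoord (inord 2) ^+ l)).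

(* The values in Omega^(0,1) (x) L_N are written as their images in A * A     *)
(* under the (injective) multiplication map (v_+, v_-) (x) xi |->             *)
(* (v_+ xi, v_- xi).                                                          *)
Definition nabla_dbar (N : nat) (xi : A) : A * A :=
  q%:C ^- N *:
    \sum_(n : 'I_N.+1 * 'I_N.+1 * 'I_N.+1 | (n.1.1 + n.1.2 + n.2 == N)%N)
      let psin := psi n.1.1 n.1.2 n.2 in
      (pstar psin * (dbar (psin * xi)).1, pstar psin * (dbar (psin * xi)).2).

(* H^0(L_N, nabla_N^dbar) *)
Definition hol_section (N : nat) (xi : A) : Prop :=
  line_bundle N xi /\ nabla_dbar N xi = 0.

(* The direct sum of the H^0(L_N, nabla_N^dbar) inside A[X]: the element      *)
(* (xi_N)_N is the polynomial \sum_N xi_N X^N.  As the product of L_N and L_M *)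
(* into L_(N + M) is the multiplication of A, the product of the direct sum   *)
(* is that of A[X].                                                           *)
Definition coord_ring (p : {poly A}) : Prop :=
  forall N, hol_section N p`_N.

End Action.

(* Main.v *)
Require Import Defs.
From HB Require Import structures.
From mathcomp Require Import all_boot all_order all_algebra perm ring zify.
From mathcomp Require Import reals complex.
Import Order.TTheory GRing.Theory Num.Theory.
Set Implicit Arguments.
Unset Strict Implicit.
Unset Printing Implicit Defensive.
Local Open Scope ring_scope.

(******************************************************************************)
(* Write z_j = u^3_j and y_j for its adjoint. Since Psi_N^dagger Psi_N = 1, on *)
(* vectors killed by F_1 the connection nabla_N is the action of F_2 up to a  *)
(* scalar, so holomorphic sections are the U_q(su(2))-invariant lowest weight *)
(* vectors of weight N, and the point is that these are spanned by the words  *)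
(* of length N in the z_j.                                                    *)
(* First, A is spanned by the words y^K (u^2)^J (u^1)^I z^M, filtered by |J|. *)
(* On the part of K_1-weight 0 the operator E_1 F_1 respects the filtration   *)
(* and is a positive scalar on each layer |J| > 0, so a vector killed by F_1  *)
(* is a combination of words y^K z^M. These are filtered by |K|; a Laplacian  *)
(* built from F_2 acts on each layer |K| > 0 by a positive scalar, so a vector *)
(* that is also killed by F_2 is a combination of words in the z_j.           *)
(* The monomials in the z_j are linearly independent because the pairings     *)
(* x |-> counit (x <| E_2^a E_1^b) separate them.                             *)
(******************************************************************************)

(** The third row of [u] satisfies the relations of the quantum plane, so [z_i |-> z_i X] defines a
    homomorphism into [{poly A}], where the power of [X] records the degree ([qplane_morphism]).

    Its image is the coordinate ring by [hol_sectionP]. There [nabla_dbar_eq0] turns holomorphy of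
    an invariant vector into being killed by [F_2], and [lowest_weight_vectors] eliminates the
    unwanted letters in two rounds, [su2_descent] and [sph_descent]. Each round uses an operator
    that kills the given vector and is triangular for a filtration by word length, with positive
    diagonal entries; hence the top layer can be removed until it is empty. The entries are
    [[h][h+1]] and [[m][m+n+2]/[2]], q-analogues of the spectra of a Casimir operator and a
    Laplacian. Triangularity rests on a few relations in [A] ([u01_comm], [u1_ustar2_comm],
    [column_rel]), checked by computing normal forms.

    Injectivity holds because [pairing_mono3] supplies functionals dual, up to positive factors, to
    the ordered monomials, and these functionals factor through the homomorphism. *)

Local Notation r0 := (ord0 : 'I_3).
Local Notation r1 := (lift ord0 ord0 : 'I_3).
Local Notation r2 := (ord_max : 'I_3).
Local Notation i1 := (ord0 : 'I_2).
Local Notation i2 := (ord_max : 'I_2).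

(** * Linear spans and eigenvectors *)

Section LinearSpan.
Variables (K : fieldType) (V : lmodType K).
Implicit Types (P : V -> Prop) (x y : V).

(** An inductive closure rather than finite sums, so that membership is used by induction on its
    derivation. *)
Inductive lspan P : V -> Prop :=
| lspan0 : lspan P 0
| lspan_base x : P x -> lspan P x
| lspanD x y : lspan P x -> lspan P y -> lspan P (x + y)
| lspanZ c x : lspan P x -> lspan P (c *: x).

Lemma lspanN P x : lspan P x -> lspan P (- x).
Proof. by move=> Px; rewrite -scaleN1r; apply: lspanZ. Qed.

Lemma lspanB P x y : lspan P x -> lspan P y -> lspan P (x - y).
Proof. by move=> Px Py; apply/lspanD/lspanN. Qed.

Lemma lspanZK P c x : c != 0 -> lspan P (c *: x) -> lspan P x.
Proof. by move=> c0 /(@lspanZ _ c^-1); rewrite scalerA mulVf // scale1r. Qed.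

Lemma lspan_sum P (I : Type) (r : seq I) (Q : pred I) (F : I -> V) :
  (forall i, Q i -> lspan P (F i)) -> lspan P (\sum_(i <- r | Q i) F i).
Proof. by move=> PF; apply: big_ind => //; [exact: lspan0 | exact: lspanD]. Qed.

Lemma lspan_rec P (H : V -> Prop) :
    H 0 -> (forall x y, H x -> H y -> H (x + y)) ->
    (forall c x, H x -> H (c *: x)) -> (forall x, P x -> H x) ->
  forall x, lspan P x -> H x.
Proof. by move=> H0 HD HZ HP x; elim=> *; auto. Qed.

Lemma lspan_sub P Q : (forall x, P x -> lspan Q x) ->
  forall x, lspan P x -> lspan Q x.
Proof.
by move=> PQ; apply: lspan_rec => //;
  [exact: lspan0 | exact: lspanD | exact: lspanZ].
Qed.

Lemma lspan_mono P Q : (forall x, P x -> Q x) ->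
  forall x, lspan P x -> lspan Q x.
Proof. by move=> PQ; apply: lspan_sub => x /PQ; apply: lspan_base. Qed.

Lemma lspan_eq0 P (f : V -> V) : linear f -> (forall x, P x -> f x = 0) ->
  forall x, lspan P x -> f x = 0.
Proof.
move=> lf f0; have fZD c x y := lf c x y.
have f00 : f 0 = 0 by have /eqP := fZD 1 0 0; rewrite !scale1r addr0 -subr_eq subrr eq_sym => /eqP.
apply: lspan_rec => // [x y fx fy|c x fx].
  by rewrite -[x]scale1r fZD fx fy scaler0 addr0.
by rewrite -[_ *: _]addr0 fZD fx f00 scaler0 addr0.
Qed.

End LinearSpan.

(* A vector of an eigenspace of T is a combination of those of the spanning  *)
(* eigenvectors that have the same eigenvalue: apply \prod_n (T - e n) over   *)
(* the other indices n that occur.                                            *)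
Section Eigenvectors.
Variables (K : fieldType) (V : lmodType K) (T : V -> V) (e : int -> K).
Hypothesis linT : linear T.
Hypothesis e_inj : injective e.
Variable P : int -> V -> Prop.
Hypothesis PT : forall n x, P n x -> T x = e n *: x.

Let Tn n x := T x - e n *: x.
Let pT (s : seq int) x := foldr Tn x s.

Let TnZD n c x y : Tn n (c *: x + y) = c *: Tn n x + Tn n y.
Proof.
by rewrite /Tn linT scalerDr scalerBr !scalerA [e n * c]mulrC opprD addrACA.
Qed.

Let TnC n m x : Tn n (Tn m x) = Tn m (Tn n x).
Proof.
have TB c y z : T (y - c *: z) = T y - c *: T z.
  by rewrite -!scaleNr ![y + _]addrC ![T y + _]addrC linT.
rewrite /Tn !TB !scalerBr !scalerA [e n * e m]mulrC !opprB.
by rewrite addrACA [RHS]addrACA [- _ - _]addrC.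
Qed.

Let pTZD s c x y : pT s (c *: x + y) = c *: pT s x + pT s y.
Proof. by elim: s => //= n s ->; rewrite TnZD. Qed.

Let pTD s x y : pT s (x + y) = pT s x + pT s y.
Proof. by rewrite -[x]scale1r pTZD !scale1r. Qed.

Let pT0 s : pT s 0 = 0.
Proof. by have /eqP := pTD s 0 0; rewrite addr0 -subr_eq subrr eq_sym => /eqP. Qed.

Let pTZ s c x : pT s (c *: x) = c *: pT s x.
Proof. by rewrite -[_ *: _]addr0 pTZD pT0 addr0. Qed.

Let pTC s t x : pT s (pT t x) = pT t (pT s x).
Proof.
elim: s => //= n s ->; elim: t (pT s x) => //= m t IH y.
by rewrite TnC IH.
Qed.

Let T0 : T 0 = 0.
Proof. by have := linT (-1) 0 0; rewrite scaler0 addr0 scaleN1r addNr. Qed.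

Let pTe s m x : T x = e m *: x -> pT s x = (\prod_(n <- s) (e m - e n)) *: x.
Proof.
move=> Tx; elim: s => /= [|n s ->]; first by rewrite big_nil scale1r.
set c := \prod_(_ <- s) _; have := linT c x 0; rewrite T0 !addr0 /Tn => ->.
by rewrite Tx !scalerA -scalerBl big_cons [c * _]mulrC -mulrBl.
Qed.

Lemma lspan_eigen m x :
  lspan (fun y => exists n, P n y) x -> T x = e m *: x -> lspan (P m) x.
Proof.
have e_neq n : n != m -> e m - e n != 0.
  by rewrite subr_eq0; apply: contraNneq => /e_inj ->.
(* [s] gathers the foreign indices met in the derivation of [x]. On [x] itself the product over [s]
   is a nonzero scalar because [e] is injective. *)
suff H : lspan (fun y => exists n, P n y) x ->
    exists2 s, m \notin s & lspan (P m) (pT s x).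
  move=> /H[s ms] + Tx; rewrite (pTe s Tx) => /lspanZK; apply.
  rewrite prodf_seq_neq0; apply/allP => n ns /=; apply: e_neq.
  by apply: contraNneq ms => <-.
have stab s y : lspan (P m) y -> lspan (P m) (pT s y).
  elim=> {y} [|y Py|y z _ IHy _ IHz|c y _ IH].
  - by rewrite pT0; apply: lspan0.
  - by rewrite (pTe s (PT Py)); apply/lspanZ/lspan_base.
  - by rewrite pTD; apply: lspanD.
  - by rewrite pTZ; apply: lspanZ.
elim=> {x} [|x [n Px]|x y _ [s ms Hs] _ [t mt Ht]|c x _ [s ms Hs]].
- by exists [::] => //=; apply: lspan0.
- have [nm|nm] := eqVneq n m.
    by exists [::] => //=; apply: lspan_base; rewrite -nm.
  exists [:: n]; first by rewrite inE eq_sym.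
  by rewrite /= /Tn (PT Px) subrr; apply: lspan0.
- exists (s ++ t); first by rewrite mem_cat negb_or ms.
  have -> z : pT (s ++ t) z = pT s (pT t z) by rewrite /pT foldr_cat.
  by rewrite !pTD pTC; apply/lspanD; apply: stab.
- by exists s => //; rewrite pTZ; apply: lspanZ.
Qed.

End Eigenvectors.

(** * Identities in the quantum matrix algebra *)

Definition ustar (R : realType) (q : R) (i j : 'I_3) : SUq3 q :=
  pgen _ (Austar i j).

Lemma big_perm3 (V : nmodType) (F : 'S_3 -> V) :
  let a := tperm (inord 0) (inord 1) : 'S_3 in
  let b := tperm (inord 1) (inord 2) : 'S_3 in
  let c := tperm (inord 0) (inord 2) : 'S_3 in
  \sum_s F s = F 1%g + F a + F b + F c + F (a * b)%g + F (b * a)%g.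
Proof.
move=> a b c; pose l := [:: 1; a; b; c; a * b; b * a]%g.
have Ul : uniq l.
  pose f (s : 'S_3) := [seq val (s (inord i)) | i <- [:: 0%N; 1%N; 2]].
  apply: (@map_uniq _ _ f).
  rewrite /= /f /a /b /c /=.
  rewrite !(permM, perm1, permE) /=.
  rewrite -!val_eqE /= !inordK //=.
have El : perm_eq (index_enum 'S_3) l.
  rewrite /index_enum -enumT; apply: uniq_perm => //; first exact: enum_uniq.
  have sl : {subset l <= enum 'S_3} by move=> s _; rewrite mem_enum.
  have szl : (size (enum 'S_3) <= size l)%N. by rewrite -cardE card_Sn.
  by have [_ H] := uniq_min_size Ul sl szl; move=> s; rewrite H.
rewrite (perm_big _ El) /= !big_cons big_nil addr0.
by rewrite !addrA.
Qed.

Lemma perm_length3 (s : 'S_3) : perm_length s =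
  ((s (inord 1) < s (inord 0)) + (s (inord 2) < s (inord 0))
   + (s (inord 2) < s (inord 1)))%N.
Proof.
rewrite /perm_length -sum1dep_card.
rewrite -(pair_big_dep xpredT (fun i j : 'I_3 => (i < j)%N && (s j < s i)%N) (fun _ _ => 1%N)) /=.
rewrite !big_ord_recl !big_ord0 /= !big_mkcond /= !big_ord_recl !big_ord0 /=.
have -> : inord 0 = ord0 :> 'I_3 by apply: val_inj; rewrite /= inordK.
have -> : inord 1 = lift ord0 ord0 :> 'I_3 by apply: val_inj; rewrite /= inordK.
have -> : inord 2 = lift ord0 (lift ord0 ord0) :> 'I_3 by apply: val_inj; rewrite /= inordK.
rewrite !big_mkcond /= !big_ord_recl !big_ord0 /= /bump /=.
rewrite big_mkcond /= !big_ord_recl !big_ord0 /=.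
by do 3!case: (leq (S (nat_of_ord (s _))) (nat_of_ord (s _))).
Qed.

Section Relations.
Variables (R : realType) (q : R).
Local Open Scope complex_scope.
Hypothesis q_neq0 : q != 0.
Local Notation A := (SUq3 q).
Local Notation C := R[i].
Local Notation Q := (q%:C : C).
Local Notation u := (Agen_u q).
Local Notation us := (ustar q).

Lemma Q_neq0 : Q != 0. Proof. by rewrite fmorph_eq0. Qed.

Lemma u_col (i j k : 'I_3) : (i < j)%N -> u i k * u j k = Q *: (u j k * u i k).
Proof.
move=> ij; rewrite /Agen_u /pgen -!pclsM -pclsZ.
exact/pclsP/tc_rel/star_rel_base/Aq_col.
Qed.

Lemma u_row (i j k : 'I_3) : (i < j)%N -> u k i * u k j = Q *: (u k j * u k i).
Proof.
move=> ij; rewrite /Agen_u /pgen -!pclsM -pclsZ.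
exact/pclsP/tc_rel/star_rel_base/Aq_row.
Qed.

Lemma u_comm (i j k l : 'I_3) : (i < j)%N -> (k < l)%N ->
  u i l * u j k = u j k * u i l.
Proof.
move=> ij kl; rewrite /Agen_u /pgen -!pclsM.
exact/pclsP/tc_rel/star_rel_base/Aq_comm.
Qed.

Lemma u_cross (i j k l : 'I_3) : (i < j)%N -> (k < l)%N ->
  u i k * u j l = u j l * u i k + (Q - Q^-1) *: (u i l * u j k).
Proof.
move=> ij kl; apply/eqP; rewrite addrC -subr_eq; apply/eqP.
rewrite /Agen_u /pgen -!pclsM -scaleN1r -!pclsZ -pclsD.
exact/pclsP/tc_rel/star_rel_base/Aq_cross.
Qed.

Lemma ustar_minor (i j k1 k2 l1 l2 : 'I_3) :
    (k1 < k2)%N -> k1 != i -> k2 != i -> (l1 < l2)%N -> l1 != j -> l2 != j ->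
  us i j = (- Q) ^ (j%:Z - i%:Z) *:
             (u k1 l1 * u k2 l2 - Q *: (u k1 l2 * u k2 l1)).
Proof.
move=> h1 h2 h3 h4 h5 h6; rewrite {1}/ustar /pgen.
have /pclsP -> := tc_rel (star_rel_base Astar_gen (Aq_star q h1 h2 h3 h4 h5 h6)).
by rewrite pclsZ pclsD pclsZ pclsZ !pclsM scaleN1r.
Qed.

Lemma u_det :
  \sum_(s : 'S_3) (- Q) ^+ perm_length s *:
     (u (inord 0) (s (inord 0)) * u (inord 1) (s (inord 1))
      * u (inord 2) (s (inord 2))) = 1 :> A.
Proof.
have /pclsP := tc_rel (star_rel_base Astar_gen (Aq_det q)).
rewrite (big_morph (pcls _) (@pclsD _ _ _) (_ : pcls _ (Cst 0) = 0)); last first.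
  by rewrite pcls_cst scale0r.
move=> det1; rewrite -[RHS]det1; apply: eq_bigr => s _.
by rewrite pclsZ !pclsM.
Qed.

End Relations.

(* Normal forms in the algebra of quantum 3 x 3 matrices, by reflection: the  *)
(* letter 3 * i + j stands for u^(i+1)_(j+1), a term is (c, e, w) for         *)
(* c q^e w, and words are sorted in increasing order.                         *)
Local Notation row a := (divn a 3).
Local Notation col a := (modn a 3).

Definition nc_term : Type := int * int * seq nat.

Definition nc_mul (p r : seq nc_term) : seq nc_term :=
  [seq (x.1.1 * y.1.1, x.1.2 + y.1.2, x.2 ++ y.2) | x <- p, y <- r].

(** For [b < a], the defining relations read as rules that sort the word [a b]; [mixed] is already
    increasing. *)
Definition nc_rule (a b : nat) : seq nc_term :=
  let swap := [:: b; a] in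
  if (row a == row b) || (col a == col b) then [:: (1, - 1, swap)]
  else if (col a < col b)%N then [:: (1, 0, swap)]
  else let mixed := [:: row b * 3 + col a; row a * 3 + col b]%N in
       [:: (1, 0, swap); (- 1, 1, mixed); (1, - 1, mixed)].

Fixpoint nc_step (w : seq nat) : option (seq nc_term) :=
  if w is a :: w' then
    if w' is b :: w'' then
      if (b < a < 9)%N then Some (nc_mul (nc_rule a b) [:: (1, 0, w'')])
      else omap (nc_mul [:: (1, 0, [:: a])]) (nc_step w')
    else None
  else None.

Fixpoint nc_nf (n : nat) (w : seq nat) : seq nc_term :=
  if n is n'.+1 then
    if nc_step w is Some p then
      flatten [seq nc_mul [:: (x.1, [::])] (nc_nf n' x.2) | x <- p]
    else [:: (1, 0, w)]
  else [:: (1, 0, w)].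

Definition nc_nfp (n : nat) (p : seq nc_term) : seq nc_term :=
  flatten [seq nc_mul [:: (x.1, [::])] (nc_nf n x.2) | x <- p].

Definition nc_key (x : nc_term) : int * seq nat := (x.1.2, x.2).

(** A sufficient test for zero: integer coefficients are added up separately for each pair of a
    power of [q] and a word. *)
Definition nc_is0 (p : seq nc_term) : bool :=
  all (fun k => foldr +%R 0 [seq x.1.1 | x <- p & nc_key x == k] == 0)
      (map nc_key p).

Section Eval.
Variables (R : realType) (q : R).
Local Open Scope complex_scope.
Hypothesis q_neq0 : q != 0.
Local Notation A := (SUq3 q).
Local Notation C := R[i].
Local Notation Q := (q%:C : C).

Definition nc_word (w : seq nat) : A :=
  \prod_(a <- w) Agen_u q (inord (row a)) (inord (col a)).

Definition nc_eval (p : seq nc_term) : A :=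
  \sum_(x <- p) (x.1.1%:~R * Q ^ x.1.2) *: nc_word x.2.

Let Q0 : Q != 0. Proof. exact: Q_neq0. Qed.

Lemma nc_eval_cat p r : nc_eval (p ++ r) = nc_eval p + nc_eval r.
Proof. by rewrite /nc_eval big_cat. Qed.

Lemma nc_evalM p r : nc_eval (nc_mul p r) = nc_eval p * nc_eval r.
Proof.
rewrite /nc_eval /nc_mul big_allpairs_dep mulr_suml; apply: eq_bigr => x _.
rewrite mulr_sumr; apply: eq_bigr => y _ /=.
rewrite /nc_word big_cat /= -scalerAl -scalerAr scalerA intrM expfzDr //.
by congr (_ *: _); rewrite mulrACA.
Qed.

Lemma nc_eval1 w : nc_eval [:: (1, 0, w)] = nc_word w.
Proof. by rewrite /nc_eval big_seq1 /= expr0z mulr1 scale1r. Qed.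

Lemma nc_rule_ok a b : (b < a < 9)%N ->
  nc_word [:: a; b] = nc_eval (nc_rule a b).
Proof.
case/andP=> ba a9.
have [i j ij] : [/\ (row a < 3)%N, (row b < 3)%N & (row b <= row a)%N].
  by split; lia.
have [am bm] : (col a < 3)%N /\ (col b < 3)%N by rewrite !ltn_mod.
rewrite /nc_rule /nc_word !big_cons big_nil mulr1.
have uV x y : x = Q *: y -> y = Q^-1 *: x by move->; rewrite scalerA mulVf ?scale1r.
case: ifP => [/orP[/eqP e|/eqP e]|/negbT/norP[ni nj]].
- rewrite e /nc_eval big_seq1 /= /nc_word !big_cons big_nil mulr1 mul1r exprN1.
  rewrite e; apply: uV; apply: u_row; rewrite !inordK //.
  by move: ba e; clear; lia.
- rewrite e /nc_eval big_seq1 /= /nc_word !big_cons big_nil mulr1 mul1r exprN1.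
  rewrite e; apply: uV; apply: u_col; rewrite !inordK //.
  by move: ba e; clear; lia.
have {}ij : (row b < row a)%N by rewrite ltn_neqAle eq_sym ni.
case: ifP => [ab|/negbT]; last rewrite -leqNgt leq_eqVlt eq_sym (negPf nj) /= => ab.
  rewrite nc_eval1 /nc_word !big_cons big_nil mulr1.
  by rewrite [RHS]u_comm // !inordK.
rewrite /nc_eval !big_cons big_nil /= /nc_word !big_cons big_nil !mulr1.
have mix c d : row (row c * 3 + col d) = row c /\ col (row c * 3 + col d) = col d.
  by split; lia.
rewrite !(mix a b).1 !(mix a b).2 !(mix b a).1 !(mix b a).2.
rewrite (@u_cross _ q (inord (row b)) (inord (row a)) (inord (col b)) (inord (col a))) ?inordK //.
rewrite addr0 !mulrNz mulr1z scale1r expr1z exprN1 mulN1r mul1r -addrA.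
by rewrite -!scalerDl [- Q + _]addrC -(opprB Q) subrr scale0r addr0.
Qed.

Lemma nc_step_ok w p : nc_step w = Some p -> nc_word w = nc_eval p.
Proof.
elim: w p => //= a [|b w] // IH p.
have cons_word c v : nc_word (c :: v) = nc_eval [:: (1, 0, [:: c])] * nc_word v.
  by rewrite nc_eval1 /nc_word !big_cons big_nil mulr1.
case: ifP => [ab [<-]|_].
  by rewrite nc_evalM -nc_rule_ok // nc_eval1 /nc_word -big_cat.
case E : (nc_step _) => [r|] // [<-].
by rewrite cons_word nc_evalM (IH _ E).
Qed.

(** Every rewriting step is an equality in the algebra, so the value is kept whatever the fuel [n];
    too little fuel can only leave words unsorted. *)
Lemma nc_nf_ok n w : nc_eval (nc_nf n w) = nc_word w.
Proof.
elim: n w => [|n IH] w /=; first by rewrite nc_eval1.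
case E : (nc_step w) => [p|]; last by rewrite nc_eval1.
rewrite (nc_step_ok E) {E} /nc_eval big_flatten big_map; apply: eq_bigr => x _.
rewrite -/(nc_eval _) nc_evalM IH /nc_eval big_seq1 /=.
by rewrite /nc_word big_nil mulr_algl.
Qed.

Lemma nc_nfp_ok n p : nc_eval (nc_nfp n p) = nc_eval p.
Proof.
rewrite /nc_eval big_flatten big_map; apply: eq_bigr => x _.
rewrite -/(nc_eval _) nc_evalM nc_nf_ok /nc_eval big_seq1 /=.
by rewrite /nc_word big_nil mulr_algl.
Qed.

Lemma nc_is0_ok p : nc_is0 p -> nc_eval p = 0.
Proof.
move=> /allP p0; rewrite /nc_eval.
rewrite (eq_big_seq (fun x => \sum_(k <- undup (map nc_key p) | nc_key x == k)
          (x.1.1%:~R * Q ^ k.1) *: nc_word k.2)); last first.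
  move=> x xp; rewrite big_mkcond /= (bigD1_seq (nc_key x)) ?undup_uniq //=.
    by rewrite eqxx big1 ?addr0 // => k; rewrite eq_sym => /negPf->.
  by rewrite mem_undup map_f.
under eq_bigr do rewrite big_mkcond.
rewrite exchange_big big_seq big1 //= => k; rewrite mem_undup => /p0/eqP sk.
rewrite -big_mkcond /= -scaler_suml -mulr_suml -(rmorph_sum (intmul 1)) /=.
by rewrite -big_filter -(big_map (fun x : nc_term => x.1.1) xpredT id) -foldrE sk mul0r scale0r.
Qed.

(* 20 bounds the number of inversions removed in the words of length at most 3 *)
(* that occur below.                                                          *)
Lemma nc_identity p : nc_is0 (nc_nfp 20 p) -> nc_eval p = 0.
Proof. by move=> /nc_is0_ok; rewrite nc_nfp_ok. Qed.

End Eval.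

Lemma ord3_ind (P : 'I_3 -> Prop) : P r0 -> P r1 -> P r2 -> forall i, P i.
Proof.
move=> P0 P1 P2 [[|[|[|]]] hi] //.
- by rewrite (_ : Ordinal hi = r0) //; apply: val_inj.
- by rewrite (_ : Ordinal hi = r1) //; apply: val_inj.
- by rewrite (_ : Ordinal hi = r2) //; apply: val_inj.
Qed.

(** * Sphere, column and exchange relations *)

Definition nc_u (i j : nat) : seq nc_term := [:: (1, 0, [:: (3 * i + j)%N])].

(** [k1 < k2] are the rows other than [i], [l1 < l2] the columns other than [j], and the leading
    factor spells [(-q)^(j-i)]. *)
Definition nc_ustar (i j : nat) : seq nc_term :=
  let k1 := nat_of_bool (i == 0)%N in let k2 := (1 + (i != 2))%N in
  let l1 := nat_of_bool (j == 0)%N in let l2 := (1 + (j != 2))%N in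
  nc_mul [:: ((- 1) ^+ (i + j), j%:Z - i%:Z, [::])]
    [:: (1, 0, [:: 3 * k1 + l1; 3 * k2 + l2]%N);
        (- 1, 1, [:: 3 * k1 + l2; 3 * k2 + l1]%N)].

(** The terms follow [big_perm3]: the identity, three transpositions, two 3-cycles. *)
Definition nc_det : seq nc_term :=
  [:: (1, 0, [:: 0%N; 4; 8]); (- 1, 1, [:: 1%N; 3; 8]);
      (- 1, 1, [:: 0%N; 5; 7]); (- 1, 3, [:: 2; 4; 6]);
      (1, 2, [:: 2; 3; 7]); (1, 2, [:: 1%N; 5; 6])].

Section Identities.
Variables (R : realType) (q : R).
Local Open Scope complex_scope.
Hypothesis q_neq0 : q != 0.
Local Notation C := R[i].
Local Notation Q := (q%:C : C).
Local Notation u := (Agen_u q).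
Local Notation us := (ustar q).
Local Notation ev := (nc_eval q).

Let Q0 : Q != 0. Proof. exact: Q_neq0. Qed.

Lemma nc_uW (i j : 'I_3) : u i j = nc_word q [:: (3 * i + j)%N].
Proof.
rewrite /nc_word big_seq1.
have -> : ((3 * i + j) %/ 3 = i)%N by have := ltn_ord j; lia.
have -> : ((3 * i + j) %% 3 = j)%N by have := ltn_ord j; lia.
by rewrite !inord_val.
Qed.

Lemma nc_uE (i j : 'I_3) : u i j = ev (nc_u i j).
Proof. by rewrite nc_eval1 nc_uW. Qed.

Lemma nc_wordM w v : nc_word q w * nc_word q v = nc_word q (w ++ v).
Proof. by rewrite /nc_word big_cat. Qed.

Lemma nc_scale c e p : ev (nc_mul [:: (c, e, [::])] p) = (c%:~R * Q ^ e) *: ev p.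
Proof.
rewrite nc_evalM // {1}/nc_eval big_seq1 /= /nc_word big_nil.
by rewrite mulr_algl.
Qed.

Lemma nc_ustarE (i j : 'I_3) : us i j = ev (nc_ustar i j).
Proof.
have lt2 (b : bool) : (b.+1 < 3)%N by case: b.
have lt1 (b : bool) : (b < 3)%N by case: b.
pose o1 (k : 'I_3) := Ordinal (lt1 ((k : nat) == 0)%N).
pose o2 (k : 'I_3) := Ordinal (lt2 ((k : nat) != 2)).
have o12 k : [/\ (o1 k < o2 k)%N, o1 k != k & o2 k != k].
  by elim/ord3_ind: k.
have [hi1 hi2 hi3] := o12 i; have [hj1 hj2 hj3] := o12 j.
rewrite (ustar_minor q hi1 hi2 hi3 hj1 hj2 hj3).
rewrite /nc_ustar nc_scale /=; congr (_ *: _).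
  rewrite -[- Q]mulN1r expfzMl; congr (_ * _).
  rewrite expfzDr ?oppr_eq0 ?oner_eq0 //.
  rewrite -exprz_inv invrN1 -exprnP -exprD addnC rmorphXn rmorphN1 //.
rewrite !nc_uW !nc_wordM /nc_eval !big_cons big_nil /= !add1n addr0.
by rewrite !mulrNz mulr1z !mul1r expr0z scale1r expr1z mulN1r scaleNr.
Qed.

Lemma nc_detE : ev nc_det = 1.
Proof.
rewrite -[RHS](u_det q) big_perm3 !perm_length3.
have t0 : inord 0 = r0 by apply: val_inj; rewrite /= inordK.
have t1 : inord 1 = r1 by apply: val_inj; rewrite /= inordK.
have t2 : inord 2 = r2 by apply: val_inj; rewrite /= inordK.
rewrite t0 t1 t2 !(permM, perm1, permE) /= !nc_uW !nc_wordM.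
rewrite /nc_eval !big_cons big_nil /= addr0 !addrA.
rewrite !mulrNz !mulr1z !mul1r expr0z expr1z !mulN1r.
do ![congr (_ + _)]; congr (_ *: _).
all: by rewrite -exprnP ?[RHS]sqrrN // [RHS]exprNn -signr_odd mulN1r.
Qed.

Lemma nc_eq (p r : seq nc_term) :
  nc_is0 (nc_nfp 20 (p ++ nc_mul [:: (- 1, 0, [::])] r)) -> ev p = ev r.
Proof.
move=> /(nc_identity q_neq0); rewrite nc_eval_cat nc_scale.
by rewrite mulrNz mulr1z expr0z mulr1 scaleN1r => /subr0_eq.
Qed.

(** Laplace expansion of the quantum determinant along the third row. Writing 1 as [nc_det] makes
    both sides cubic in the [u^i_j], where normal forms decide the equality. *)
Lemma sphere_rel : \sum_j u r2 j * us r2 j = 1.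
Proof.
rewrite -nc_detE !big_ord_recl big_ord0 addr0.
rewrite !nc_uE !nc_ustarE -!nc_evalM // -!nc_eval_cat.
by apply: nc_eq; vm_compute.
Qed.

(** A Laplace expansion along a column, with column [j] put in place of column [k]: it gives the
    determinant if [k = j] and vanishes otherwise. *)
Lemma column_rel k j : \sum_i us i k * u i j = (k == j)%:R.
Proof.
have -> : (k == j)%:R = ev (nc_mul [:: ((k == j)%:Z, 0, [::])] nc_det).
  by rewrite nc_scale nc_detE expr0z mulr1 scaler_int.
rewrite !big_ord_recl big_ord0 addr0.
rewrite !nc_uE !nc_ustarE -!nc_evalM // -!nc_eval_cat.
by apply: nc_eq; elim/ord3_ind: k; elim/ord3_ind: j; vm_compute.
Qed.

(** The failure of [u^1_a] and [u^2_b] to q-commute is a multiple of a minor of the first two rows,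
    and such a minor is a scalar times the adjoint of [z_k], with [k] the remaining column. *)
Lemma u01_comm a b : exists c k,
  u r0 a * u r1 b = Q *: (u r1 a * u r0 b) + c *: us r2 k.
Proof.
have aux c e (k : 'I_3) : nc_is0 (nc_nfp 20 (nc_mul (nc_u r0 a) (nc_u r1 b) ++
    nc_mul [:: (- 1, 0, [::])] (nc_mul [:: (1, 1, [::])] (nc_mul (nc_u r1 a) (nc_u r0 b))
    ++ nc_mul [:: (c, e, [::])] (nc_ustar r2 k)))) ->
    exists c k, u r0 a * u r1 b = Q *: (u r1 a * u r0 b) + c *: us r2 k.
  move=> /nc_eq; rewrite nc_eval_cat [X in _ = _ + X]nc_scale -nc_ustarE.
  rewrite nc_scale !nc_evalM // -!nc_uE.
  by rewrite mul1r expr1z => ->; exists (c%:~R * Q ^ e), k.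
elim/ord3_ind: a aux; elim/ord3_ind: b => aux.
- by apply: (aux 0 0 r0); vm_compute.
- by apply: (aux 1 0 r2); vm_compute.
- by apply: (aux (- 1) 1 r1); vm_compute.
- by apply: (aux (- 1) 1 r2); vm_compute.
- by apply: (aux 0 0 r0); vm_compute.
- by apply: (aux 1 2 r0); vm_compute.
- by apply: (aux 1 2 r1); vm_compute.
- by apply: (aux (- 1) 3 r0); vm_compute.
- by apply: (aux 0 0 r0); vm_compute.
Qed.
(** Carries the adjoint of [z_k] produced by [u01_comm] leftwards past letters [u^2]. The lists in
    the proof are the explicit expansions, entries [(c, e, (l, b))] standing for the coefficient
    [c q^e]; only [a = k] gives several terms. *)
Lemma u1_ustar2_comm a k :
  lspan (fun x => exists l b, x = us r2 l * u r1 b) (u r1 a * us r2 k).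
Proof.
have aux (t : seq (int * int * ('I_3 * 'I_3))) :
   nc_is0 (nc_nfp 20 (nc_mul (nc_u r1 a) (nc_ustar r2 k) ++
     nc_mul [:: (- 1, 0, [::])] (flatten [seq nc_mul [:: (x.1, [::])]
       (nc_mul (nc_ustar r2 x.2.1) (nc_u r1 x.2.2)) |
         x : int * int * ('I_3 * 'I_3) <- t]))) ->
  lspan (fun x => exists l b, x = us r2 l * u r1 b) (u r1 a * us r2 k).
  move=> /nc_eq; rewrite nc_evalM // -nc_uE -nc_ustarE => ->.
  rewrite /nc_eval big_flatten big_map; apply: lspan_sum => -[[c e] [l b]] _.
  rewrite -/(nc_eval _ _) nc_scale nc_evalM // -nc_uE -nc_ustarE.
  by apply/lspanZ/lspan_base; exists l, b.
elim/ord3_ind: a aux; elim/ord3_ind: k => aux.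
- by apply: (aux [:: (1, 1, (r0, r0))]); vm_compute.
- by apply: (aux [:: (1, 0, (r1, r0))]); vm_compute.
- by apply: (aux [:: (1, 0, (r2, r0))]); vm_compute.
- by apply: (aux [:: (1, 0, (r0, r1))]); vm_compute.
- by apply: (aux [:: (1, 3, (r0, r0)); (- 1, 1, (r0, r0)); (1, 1, (r1, r1))]); vm_compute.
- by apply: (aux [:: (1, 0, (r2, r1))]); vm_compute.
- by apply: (aux [:: (1, 0, (r0, r2))]); vm_compute.
- by apply: (aux [:: (1, 0, (r1, r2))]); vm_compute.
- by apply: (aux [:: (1, 5, (r0, r0)); (- 1, 3, (r0, r0)); (1, 3, (r1, r1));
                     (- 1, 1, (r1, r1)); (1, 1, (r2, r2))]); vm_compute.
Qed.

Lemma u_exchange (i j : 'I_3) : i != j -> forall a b,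
  lspan (fun x => exists c d, x = u j c * u i d) (u i a * u j b).
Proof.
have B c d : lspan (fun x => exists c d, x = u j c * u i d) (u j c * u i d).
  by apply: lspan_base; exists c, d.
rewrite -val_eqE neq_ltn => /orP[] ij a b.
- case: (ltngtP a b) => [ab|ba|/val_inj->].
  + by rewrite (u_cross q ij ab) (u_comm q ij ab); apply/lspanD/lspanZ/B/B.
  + by rewrite (u_comm q ij ba); apply: B.
  + by rewrite (u_col q _ ij); apply/lspanZ/B.
- case: (ltngtP a b) => [ab|ba|/val_inj->].
  + by rewrite -(u_comm q ij ab); apply: B.
  + have /eqP := u_cross q ij ba; rewrite -subr_eq => /eqP<-.
    by apply/lspanB/lspanZ/B/B.
  + have /esym/(congr1 (GRing.scale Q^-1)) := u_col q b ij.
    by rewrite scalerA mulVf // scale1r => ->; apply/lspanZ/B.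
Qed.

End Identities.

(** * The operators K_i, E_i and F_i *)

Section Star.
Variables (R : realType) (q : R).
Local Notation A := (SUq3 q).

Lemma Astar_genK : involutive Astar_gen. Proof. by case. Qed.

Implicit Types a b : A.

Lemma pstarM a b : pstar (a * b) = (pstar b : A) * (pstar a : A) :> A.
Proof.
elim/palg_ind: a => s; elim/palg_ind: b => t.
by rewrite -pclsM !(pstar_pcls _ Astar_genK) -pclsM.
Qed.

Lemma pstarD a b : pstar (a + b) = (pstar a : A) + (pstar b : A) :> A.
Proof.
elim/palg_ind: a => s; elim/palg_ind: b => t.
by rewrite -pclsD !(pstar_pcls _ Astar_genK) -pclsD.
Qed.

Lemma pstarZ c a : pstar (c *: a) = Num.conj c *: (pstar a : A) :> A.
Proof.
elim/palg_ind: a => s; rewrite -pclsZ !(pstar_pcls _ Astar_genK) /=.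
by rewrite -pclsZ; apply/pclsP/tc_sym/tc_cstC.
Qed.

Lemma pstar1 : pstar 1 = 1 :> A.
Proof. by rewrite -pcls1 (pstar_pcls _ Astar_genK) /= conjC1. Qed.

Lemma pstarK : involutive (pstar : A -> A).
Proof.
elim/palg_ind=> s; rewrite !(pstar_pcls _ Astar_genK).
by rewrite (tstarK Astar_genK).
Qed.

Lemma pstar_u i j : pstar (Agen_u q i j) = ustar q i j.
Proof. by rewrite (pstar_pcls _ Astar_genK). Qed.

End Star.

Section Operators.
Variables (R : realType) (q : R) (act : SUq3 q -> Uqsu3 q -> SUq3 q).
(** The proof of [su3_action] is an argument so that linearity can be attached to [op H h] as a
    canonical structure. *)
Definition op (_ : su3_action act) (h : Uqsu3 q) (a : SUq3 q) := act a h.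
Variable H : su3_action act.
HB.instance Definition _ h :=
  GRing.isLinear.Build R[i] (SUq3 q) (SUq3 q) *:%R (op H h) (act_linearl H h).
End Operators.

Section Operators.
Variables (R : realType) (q : R) (act : SUq3 q -> Uqsu3 q -> SUq3 q).
Hypotheses (q_gt0 : 0 < q) (q_lt1 : q < 1) (H : su3_action act).
Local Open Scope complex_scope.
Local Notation A := (SUq3 q).
Local Notation C := R[i].
Local Notation Q := (q%:C : C).
Local Notation S := ((Num.sqrt q)%:C : C).
Local Notation u := (Agen_u q).
Local Notation us := (ustar q).
Local Notation K i := (op H (Ugen_K q i)).
Local Notation L i := (op H (pgen _ (UKinv i))).
Local Notation E i := (op H (Ugen_E q i)).
Local Notation F i := (op H (Ugen_F q i)).
Implicit Types a b : A.

Lemma sqrt_gt0 : 0 < S. Proof. by rewrite ltcR sqrtr_gt0. Qed.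
Lemma sqrt_neq0 : S != 0. Proof. by rewrite gt_eqF ?sqrt_gt0. Qed.
Lemma sqrtXz_gt0 n : 0 < S ^ n. Proof. exact/exprz_gt0/sqrt_gt0. Qed.
Lemma sqrtXz_neq0 n : S ^ n != 0. Proof. by rewrite gt_eqF ?sqrtXz_gt0. Qed.
Lemma QE : Q = S ^+ 2. Proof. by rewrite -rmorphXn /= sqr_sqrtr ?ltW. Qed.

(** For a right action the left factor acts first, so the relations of [U_q(su(3))] appear below
    with the operators in reversed order. *)
Lemma opM h g a : op H (h * g) a = op H g (op H h a).
Proof. exact: act_comp. Qed.

Lemma op_inv (h g : Uqsu3 q) a : h * g = 1 -> op H g (op H h a) = a.
Proof. by rewrite -opM => ->; exact: act_id. Qed.

Lemma op_scale c h a : op H (c *: h) a = c *: op H h a.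
Proof.
have lin := act_linearr H a; have := lin c h 0; rewrite addr0 /op => ->.
have := lin (-1) 0 0; rewrite scaler0 addr0 scaleN1r addNr => ->.
by rewrite addr0.
Qed.

Lemma op_add h g a : op H (h + g) a = op H h a + op H g a.
Proof.
by have := act_linearr H a 1 h g; rewrite !scale1r.
Qed.

Lemma KL i a : K i (L i a) = a.
Proof.
apply: op_inv; rewrite /Ugen_K /pgen -pclsM -pcls1.
exact/pclsP/tc_rel/star_rel_base/Uq_KinvK.
Qed.

Lemma LK i a : L i (K i a) = a.
Proof.
apply: op_inv; rewrite /Ugen_K /pgen -pclsM -pcls1.
exact/pclsP/tc_rel/star_rel_base/Uq_KKinv.
Qed.

Lemma KEcomm i a : E i (K i a) = Q *: K i (E i a).
Proof.
rewrite -!opM -op_scale; congr (op _ _ _).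
rewrite /Ugen_K /Ugen_E /pgen -!pclsM -pclsZ.
exact/pclsP/tc_rel/star_rel_base/Uq_KE.
Qed.

Lemma KEcomm' (i j : 'I_2) a : i != j -> E j (K i a) = S^-1 *: K i (E j a).
Proof.
move=> ij; rewrite -!opM -op_scale; congr (op _ _ _).
rewrite /Ugen_K /Ugen_E /pgen -!pclsM -pclsZ.
by apply/pclsP/tc_rel/star_rel_base/Uq_KE'.
Qed.

Lemma conj_real (x : R) : Num.conj (x%:C : C) = x%:C.
Proof. exact: conjc_real. Qed.

Lemma KFcomm i a : K i (F i a) = Q *: F i (K i a).
Proof.
rewrite -!opM -op_scale; congr (op _ _ _).
rewrite /Ugen_K /Ugen_F /pgen -!pclsM -pclsZ.
have /pclsP -> := tc_rel (star_rel_star Ustar_gen (Uq_KE q i)).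
rewrite /= conj_real; exact/pclsP/tc_sym/tc_cstC.
Qed.

Lemma KFcomm' (i j : 'I_2) a : i != j -> K i (F j a) = S^-1 *: F j (K i a).
Proof.
move=> ij; rewrite -!opM -op_scale; congr (op _ _ _).
rewrite /Ugen_K /Ugen_F /pgen -!pclsM -pclsZ.
have /pclsP -> := tc_rel (star_rel_star Ustar_gen (Uq_KE' q ij)).
rewrite /= fmorphV /= conj_real; exact/pclsP/tc_sym/tc_cstC.
Qed.

Lemma EFcomm' (i j : 'I_2) a : i != j -> F j (E i a) = E i (F j a).
Proof.
move=> ij; rewrite -!opM; congr (op _ _ _).
rewrite /Ugen_E /Ugen_F /pgen -!pclsM.
by apply/pclsP/tc_rel/star_rel_base/Uq_EF'.
Qed.

Lemma EFcomm i a : F i (E i a) - E i (F i a) =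
  (Q - Q^-1)^-1 *: (K i (K i a) - L i (L i a)).
Proof.
rewrite -!opM -[- op _ _ a]scaleN1r -[X in _ + X = _]op_scale -op_add.
rewrite -[- op _ _ a]scaleN1r -[- 1 *: op _ _ a]op_scale -op_add -op_scale.
congr (op _ _ _).
have /pclsP := tc_rel (star_rel_base Ustar_gen (Uq_EF q i)).
by rewrite !(pclsZ, pclsD, pclsM).
Qed.

Lemma opE_mul i a b : E i (a * b) = E i a * K i b + L i a * E i b.
Proof.
by have := act_mul H a b (Var (UE i)); rewrite /= !big_cons big_nil addr0.
Qed.

Lemma opF_mul i a b : F i (a * b) = F i a * K i b + L i a * F i b.
Proof.
by have := act_mul H a b (Var (UF i)); rewrite /= !big_cons big_nil addr0.
Qed.

Lemma opK_mul i a b : K i (a * b) = K i a * K i b.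
Proof.
by have := act_mul H a b (Var (UK i)); rewrite /= !big_cons big_nil addr0.
Qed.

Lemma opK1 i : K i 1 = 1.
Proof. by have := act_one H (Var (UK i)); rewrite /= scale1r. Qed.

Lemma opE1 i : E i 1 = 0.
Proof. by have := act_one H (Var (UE i)); rewrite /= scale0r. Qed.

Lemma opF1 i : F i 1 = 0.
Proof. by have := act_one H (Var (UF i)); rewrite /= scale0r. Qed.

Definition wt (i : 'I_2) (j : 'I_3) : int :=
  (j == row_hi i)%:Z - (j == row_lo i)%:Z.

Lemma opE_u i j k : E i (u j k) = (j == row_hi i)%:R *: u (row_lo i) k.
Proof. exact: act_E. Qed.

Lemma opF_u i j k : F i (u j k) = (j == row_lo i)%:R *: u (row_hi i) k.
Proof. exact: act_F. Qed.

Lemma opK_u i j k : K i (u j k) = S ^ wt i j *: u j k.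
Proof. exact: act_K. Qed.

Lemma UstarK : involutive Ustar_gen. Proof. by case. Qed.

Lemma Q_gt0 : 0 < Q. Proof. by rewrite ltcR. Qed.
Let Q0 : Q != 0. Proof. by rewrite gt_eqF ?Q_gt0. Qed.

(** From [act_star] at [F_i], since the adjoint of [S(F_i)] is [- q^-1 E_i]. *)
Lemma opE_us i j k : E i (us j k) = - Q *: ((j == row_lo i)%:R *: us (row_hi i) k).
Proof.
have := act_star H (u j k) (Var (UF i)); rewrite /= pstar_u.
rewrite [act (u j k) _]act_F // pstarZ conjC_nat pstar_u => ->.
rewrite (pstar_pcls _ UstarK) /= (_ : pcls _ _ = - Q^-1 *: Ugen_E q i).
  by rewrite -/(op H _ _) op_scale scalerA mulrNN mulfV // scale1r.
by rewrite -pclsZ rmorphN fmorphV /= conj_real; apply/pclsP/tc_sym/tc_cstC.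
Qed.

Lemma opF_us i j k :
  F i (us j k) = - Q^-1 *: ((j == row_hi i)%:R *: us (row_lo i) k).
Proof.
have := act_star H (u j k) (Var (UE i)); rewrite /= pstar_u.
rewrite [act (u j k) _]act_E // pstarZ conjC_nat pstar_u => ->.
rewrite (pstar_pcls _ UstarK) /= (_ : pcls _ _ = - Q *: Ugen_F q i).
  by rewrite -/(op H _ _) op_scale scalerA mulrNN mulVf // scale1r.
by rewrite -pclsZ rmorphN /= conj_real; apply/pclsP/tc_sym/tc_cstC.
Qed.

Lemma opL_us i j k : L i (us j k) = S ^ wt i j *: us j k.
Proof.
have := act_star H (u j k) (Var (UK i)); rewrite /= pstar_u.
rewrite [act (u j k) _]act_K // pstarZ pstar_u (pstar_pcls _ UstarK) /=.
by rewrite -fmorphXz conj_real.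
Qed.

(* wtv i n a : a has K_i-weight n, in units of q^(1/2). *)
Definition wtv i (n : int) a := K i a = S ^ n *: a.

Lemma wtvL i n a : wtv i n a -> L i a = (S ^ n)^-1 *: a.
Proof.
move=> Ka; rewrite -[in LHS](scale1r a) -(mulVf (sqrtXz_neq0 n)) -scalerA.
by rewrite -Ka linearZ /= LK.
Qed.

Lemma wtv1 i : wtv i 0 1. Proof. by rewrite /wtv opK1 expr0z scale1r. Qed.

Lemma wtvM i n m a b : wtv i n a -> wtv i m b -> wtv i (n + m) (a * b).
Proof.
rewrite /wtv opK_mul => -> ->.
by rewrite -scalerAl -scalerAr scalerA expfzDr ?sqrt_neq0.
Qed.

Lemma wtvZ i n c a : wtv i n a -> wtv i n (c *: a).
Proof. by rewrite /wtv linearZ /= => ->; rewrite !scalerA mulrC. Qed.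

Lemma wtv_u i j k : wtv i (wt i j) (u j k). Proof. exact: opK_u. Qed.

Lemma wtv_us i j k : wtv i (- wt i j) (us j k).
Proof.
rewrite /wtv -[us j k in LHS]scale1r -(mulVf (sqrtXz_neq0 (wt i j))) -scalerA.
by rewrite -opL_us linearZ /= KL invr_expz.
Qed.

(** The order reversal of a right action is why [E_i] lowers weights and [F_i] raises them. *)
Lemma wtvE i n a : wtv i n a -> wtv i (n - 2) (E i a).
Proof.
rewrite /wtv => Ka; have /esym := KEcomm i a; rewrite Ka linearZ /= QE.
move=> /(congr1 (GRing.scale (S ^- 2))); rewrite !scalerA mulVf ?expf_neq0 ?sqrt_neq0 //.
by rewrite scale1r => ->; rewrite mulrC expfzDr ?sqrt_neq0.
Qed.

Lemma wtvE' (i j : 'I_2) n a : i != j -> wtv i n a -> wtv i (n + 1) (E j a).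
Proof.
rewrite /wtv => ij Ka; have /esym := KEcomm' a ij; rewrite Ka linearZ /=.
move=> /(congr1 (GRing.scale S)); rewrite !scalerA mulfV ?sqrt_neq0 //.
by rewrite scale1r => ->; rewrite mulrC expfzDr ?sqrt_neq0.
Qed.

Lemma wtvF i n a : wtv i n a -> wtv i (n + 2) (F i a).
Proof.
rewrite /wtv => Ka; rewrite KFcomm Ka linearZ /= scalerA QE mulrC.
by rewrite expfzDr ?sqrt_neq0.
Qed.

Lemma wtvF' (i j : 'I_2) n a : i != j -> wtv i n a -> wtv i (n - 1) (F j a).
Proof.
rewrite /wtv => ij Ka; rewrite KFcomm' // Ka linearZ /= scalerA mulrC.
by rewrite expfzDr ?sqrt_neq0.
Qed.

Definition qint (n : nat) : C := (qnum q n)%:C.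

Lemma qintE n : qint n = (Q - Q^-1)^-1 * (S ^ n * S ^ n - (S ^ n)^-1 * (S ^ n)^-1).
Proof.
rewrite /qint /qnum rmorphM fmorphV !rmorphB !fmorphV !rmorphXn /= mulrC.
by rewrite QE -!exprnP -!exprVn -!exprMn -expr2.
Qed.

Lemma qint_gt0 n : (0 < n)%N -> 0 < qint n.
Proof.
move=> n0; rewrite /qint ltcR /qnum.
have lt1 m : (0 < m)%N -> q ^+ m - q ^- m < 0.
  move=> m0; have qm : q ^+ m < 1 by rewrite exprn_ilt1 ?ltW // -lt0n.
  have qm0 : 0 < q ^+ m by apply: exprn_gt0.
  by rewrite subr_lt0 (lt_trans qm) // invf_gt1.
have lt11 : q - q^-1 < 0 := lt1 1%N isT.
by rewrite nmulr_rgt0 ?lt1 // invr_lt0.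
Qed.

Lemma wtvKKLL i n a : wtv i n a -> K i (K i a) - L i (L i a) =
  (S ^ n * S ^ n - (S ^ n)^-1 * (S ^ n)^-1) *: a.
Proof.
move=> Ka; rewrite scalerBl -!scalerA -Ka -(wtvL Ka).
by congr (_ - _); rewrite ?Ka ?(wtvL Ka) linearZ /= ?Ka ?(wtvL Ka).
Qed.

(** On weight [n] the element [K_i^2] is [q^n], so the commutator of [E_i] and [F_i] is the scalar
    [[n]]. *)
Lemma FE_wt i (n : nat) a : wtv i n a -> F i a = 0 -> F i (E i a) = qint n *: a.
Proof.
move=> Ka Fa; have := EFcomm i a; rewrite Fa linear0 subr0 => ->.
by rewrite (wtvKKLL Ka) scalerA qintE.
Qed.

Lemma EF_wt i (n : nat) a : wtv i (- n%:Z) a -> E i a = 0 ->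
  E i (F i a) = qint n *: a.
Proof.
move=> Ka Ea; have := EFcomm i a; rewrite Ea linear0 sub0r => /(congr1 -%R).
rewrite opprK => ->.
by rewrite (wtvKKLL Ka) scalerA -scaleNr -mulrN qintE opprB -!invr_expz !invrK.
Qed.

End Operators.

(** * Lowest weight vectors *)

Section Monomials.
Variables (K : fieldType) (B : algType K) (X : Type).
Implicit Types (f g : X -> B) (J : seq X) (x y b : B) (D : B -> B).

Lemma lspan_mulr P P' b : (forall y : B, P y -> lspan P' (y * b)) ->
  forall x, lspan P x -> lspan P' (x * b).
Proof.
move=> Pb; apply: lspan_rec => // [|x y|c x].
- by rewrite mul0r; apply: lspan0.
- by rewrite mulrDl; apply: lspanD.
- by rewrite -scalerAl; apply: lspanZ.
Qed.

Lemma lspan_mull P P' b : (forall y : B, P y -> lspan P' (b * y)) ->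
  forall x, lspan P x -> lspan P' (b * x).
Proof.
move=> Pb; apply: lspan_rec => // [|x y|c x].
- by rewrite mulr0; apply: lspan0.
- by rewrite mulrDr; apply: lspanD.
- by rewrite -scalerAr; apply: lspanZ.
Qed.

Definition mono f J := \prod_(j <- J) f j.

Lemma mono_nil f : mono f [::] = 1. Proof. exact: big_nil. Qed.

Lemma mono_cons f j J : mono f (j :: J) = f j * mono f J.
Proof. exact: big_cons. Qed.

Lemma mono_rcons f J j : mono f (rcons J j) = mono f J * f j.
Proof. by rewrite /mono -cats1 big_cat big_seq1. Qed.

Definition exch f g := forall i j,
  lspan (fun x => exists k l, x = g k * f l) (f i * g j).

Lemma exch_mono f g : exch f g -> forall J j,
  lspan (fun x => exists k J', size J' = size J /\ x = g k * mono f J')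
        (mono f J * g j).
Proof.
move=> fg; elim=> [|i J IH] j.
  by rewrite mono_nil mul1r; apply: lspan_base; exists j, [::]; rewrite mono_nil mulr1.
rewrite mono_cons -mulrA; apply: lspan_mull (IH j) => _ [k [J' [sJ ->]]].
rewrite mulrA; apply: lspan_mulr (fg i k) => _ [l [m ->]].
apply: lspan_base; exists l, (m :: J'); rewrite /= sJ; split=> //.
by rewrite mono_cons mulrA.
Qed.

Section Leibniz.
Variables (D kp lb : B -> B) (f g : X -> B).
Hypotheses (D1 : D 1 = 0) (DM : forall x y, D (x * y) = D x * kp y + lb x * D y).

Lemma mono_derive0 J : (forall j, D (f j) = 0) -> D (mono f J) = 0.
Proof.
move=> Df; elim: J => [|j J IH]; first by rewrite mono_nil.
by rewrite mono_cons DM IH Df mul0r mulr0 addr0.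
Qed.

Hypothesis Df : forall j, exists c, D (f j) = c *: g j.

Lemma gatherR J : exch g f ->
    (forall j, exists c, kp (f j) = c *: f j) ->
    (forall J, exists c, lb (mono f J) = c *: mono f J) ->
  lspan (fun x => exists J' k, size J = (size J').+1 /\ x = mono f J' * g k)
        (D (mono f J)).
Proof.
move=> gf kf lf; elim/last_ind: J => [|J j IH].
  by rewrite mono_nil D1; apply: lspan0.
rewrite mono_rcons DM size_rcons; apply: lspanD.
  have [c ->] := kf j; rewrite -scalerAr; apply: lspanZ.
  apply: lspan_mulr IH => _ [J' [k [-> ->]]].
  rewrite -mulrA; apply: lspan_mull (gf k j) => _ [l [m ->]].
  apply: lspan_base; exists (rcons J' l), m; rewrite size_rcons; split=> //.
  by rewrite mono_rcons mulrA.
have [c ->] := lf J; have [d ->] := Df j.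
by rewrite -scalerAl -scalerAr; do 2!apply: lspanZ; apply: lspan_base; exists J, j.
Qed.

Lemma gatherL J : exch f g ->
    (forall J, exists c, kp (mono f J) = c *: mono f J) ->
    (forall j, exists c, lb (f j) = c *: f j) ->
  lspan (fun x => exists k J', size J = (size J').+1 /\ x = g k * mono f J')
        (D (mono f J)).
Proof.
move=> fg kf lf; elim: J => [|j J IH].
  by rewrite mono_nil D1; apply: lspan0.
rewrite mono_cons DM; apply: lspanD.
  have [c ->] := kf J; have [d ->] := Df j.
  by rewrite -scalerAr -scalerAl; do 2!apply: lspanZ; apply: lspan_base; exists j, J.
have [c ->] := lf j; rewrite -scalerAl; apply: lspanZ.
apply: lspan_mull IH => _ [k [J' [/= -> ->]]].
rewrite mulrA; apply: lspan_mulr (fg j k) => _ [l [m ->]].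
by apply: lspan_base; exists l, (m :: J'); rewrite mono_cons mulrA.
Qed.

End Leibniz.

End Monomials.

Section Words.
Variables (R : realType) (q : R) (act : SUq3 q -> Uqsu3 q -> SUq3 q).
Hypotheses (q_gt0 : 0 < q) (q_lt1 : q < 1) (H : su3_action act).
Local Open Scope complex_scope.
Local Notation A := (SUq3 q).
Local Notation C := R[i].
Local Notation Q := (q%:C : C).
Local Notation u := (Agen_u q).
Local Notation us := (ustar q).
Local Notation K i := (op H (Ugen_K q i)).
Local Notation E i := (op H (Ugen_E q i)).
Local Notation F i := (op H (Ugen_F q i)).
Implicit Types a b x y : A.

Let q0 : q != 0. Proof. by rewrite gt_eqF. Qed.
Let Q0 : Q != 0. Proof. exact: Q_neq0. Qed.

Lemma row_lo1 : row_lo i1 = r0. Proof. exact: val_inj. Qed.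
Lemma row_hi1 : row_hi i1 = r1. Proof. exact: val_inj. Qed.
Lemma row_lo2 : row_lo i2 = r1. Proof. exact: val_inj. Qed.
Lemma row_hi2 : row_hi i2 = r2. Proof. exact: val_inj. Qed.
Definition rows := (row_lo1, row_hi1, row_lo2, row_hi2).

Lemma opE_mono0 i (f : 'I_3 -> A) J : (forall j, E i (f j) = 0) -> E i (mono f J) = 0.
Proof. exact: (mono_derive0 (opE1 H i) (opE_mul H i)). Qed.

Lemma opF_mono0 i (f : 'I_3 -> A) J : (forall j, F i (f j) = 0) -> F i (mono f J) = 0.
Proof. exact: (mono_derive0 (opF1 H i) (opF_mul H i)). Qed.

Lemma wtv_mono i n (f : 'I_3 -> A) J : (forall j, wtv H i n (f j)) ->
  wtv H i (n * (size J)%:Z) (mono f J : A).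
Proof.
move=> wf; elim: J => [|j J IH] /=; first by rewrite mulr0 mono_nil; apply: wtv1.
rewrite mono_cons -add1n PoszD mulrDr mulr1; exact: (wtvM q_gt0).
Qed.

Lemma exch_u i j : i != j -> exch (u i) (u j).
Proof. by move=> ij a b; apply: u_exchange. Qed.

Lemma exch_us i j : i != j -> exch (us i) (us j).
Proof.
move=> ij a b; rewrite -!pstar_u -pstarM.
have ji : j != i by rewrite eq_sym.
elim: (u_exchange q0 ji b a) => [|x [c [d ->]]|x y _ IHx _ IHy|c x _ IH].
- have -> : pstar (0 : A) = 0 by rewrite -(scale0r (0 : A)) pstarZ conjC0 !scale0r.
  exact: lspan0.
- by apply: lspan_base; exists d, c; rewrite pstarM !pstar_u.
- by rewrite pstarD; apply: lspanD.
- by rewrite pstarZ; apply: lspanZ.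
Qed.

Local Notation Y := (mono (us r2)).
Local Notation U1 := (mono (u r1)).
Local Notation U0 := (mono (u r0)).
Local Notation Z := (mono (u r2)).

(** Letters of different rows can be exchanged, so any product of generators can be sorted by rows;
    adjoint generators enter as quadratic minors. *)
Lemma span_words a :
  lspan (fun x => exists J I M, x = U1 J * U0 I * Z M) a.
Proof.
pose W x := exists J I M, x = U1 J * U0 I * Z M.
have Wu i j x : lspan W x -> lspan W (x * u i j).
  apply: lspan_mulr => _ [J [I [M ->]]].
  elim/ord3_ind: i.
  - rewrite -mulrA; apply: lspan_mull (exch_mono (@exch_u r2 r0 _) _ _) => //.
    move=> _ [k [M' [_ ->]]]; apply: lspan_base; exists J, (rcons I k), M'.
    by rewrite mono_rcons !mulrA.
  - rewrite -mulrA; apply: lspan_mull (exch_mono (@exch_u r2 r1 _) _ _) => //.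
    move=> _ [k [M' [_ ->]]]; rewrite mulrA.
    rewrite -(mulrA (U1 J)).
    apply: (@lspan_mulr _ _ (fun x => exists J I, x = U1 J * U0 I)).
      by move=> _ [J1 [I1 ->]]; apply: lspan_base; exists J1, I1, M'.
    apply: lspan_mull (exch_mono (@exch_u r0 r1 _) _ _) => //.
    move=> _ [l [I' [_ ->]]]; apply: lspan_base; exists (rcons J l), I'.
    by rewrite mono_rcons !mulrA.
  - by apply: lspan_base; exists J, I, (rcons M j); rewrite mono_rcons !mulrA.
have W1 : W 1 by exists [::], [::], [::]; rewrite !mono_nil !mulr1.
suff P t x : lspan W x -> lspan W (x * pcls _ t).
  by rewrite -[a]mul1r; elim/palg_ind: a => t; apply/P/lspan_base.
elim: t x => [[i j|i j]|c|s IHs t IHt|s IHs t IHt] x Wx.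
- exact: Wu.
- rewrite -[pcls _ _]/(ustar q i j).
  have [k1 [k2 [l1 [l2 ->]]]] : exists k1 k2 l1 l2, us i j =
      (- Q) ^ (j%:Z - i%:Z) *: (u k1 l1 * u k2 l2 - Q *: (u k1 l2 * u k2 l1)).
    pose o (k : 'I_3) : 'I_3 * 'I_3 :=
      (if k == r0 then r1 else r0, if k == r2 then r1 else r2).
    exists (o i).1, (o i).2, (o j).1, (o j).2.
    by apply: ustar_minor; elim/ord3_ind: i; elim/ord3_ind: j.
  rewrite -scalerAr mulrBr -scalerAr; apply/lspanZ/lspanB/lspanZ.
    by rewrite mulrA; apply/Wu/Wu.
  by rewrite mulrA; apply/Wu/Wu.
- by rewrite pcls_cst -scalerAr mulr1; apply: lspanZ.
- by rewrite pclsD mulrDr; apply: lspanD; [apply: IHs | apply: IHt].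
- by rewrite pclsM mulrA; apply/IHt/IHs.
Qed.

(* E_1 F_1 is the scalar su2_eig h > 0 on su2_words h modulo su2_words h.-1,  *)
(* because u01_comm exchanges u^1 and u^2 up to a term in z^*.                *)
Definition su2_words (h : nat) x := exists K J I M,
  [/\ size J = size I, (size J <= h)%N & x = Y K * (U1 J * U0 I) * Z M].

(** Multiplication by a [U_q(su(2))]-invariant element commutes with [E_1 F_1]; this strips the
    outer factors [Y] and [Z] from a word. *)
Lemma E1F1_mull b x : wtv H i1 0 b -> E i1 b = 0 -> F i1 b = 0 ->
  E i1 (F i1 (b * x)) = b * E i1 (F i1 x).
Proof.
move=> Kb Eb Fb; rewrite opF_mul Fb mul0r add0r (wtvL q_gt0 Kb) expr0z invr1 scale1r.
by rewrite opE_mul Eb mul0r add0r (wtvL q_gt0 Kb) expr0z invr1 scale1r.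
Qed.

Lemma E1F1_mulr b x : wtv H i1 0 b -> E i1 b = 0 -> F i1 b = 0 ->
  E i1 (F i1 (x * b)) = E i1 (F i1 x) * b.
Proof.
move=> Kb Eb Fb; rewrite opF_mul Fb mulr0 addr0 Kb expr0z scale1r.
by rewrite opE_mul Eb mulr0 addr0 Kb expr0z scale1r.
Qed.

Lemma wt_Y J : wtv H i1 0 (Y J).
Proof. by rewrite -(mul0r (size J)%:Z); apply: wtv_mono => j; apply: wtv_us. Qed.

Lemma wt_Z J : wtv H i1 0 (Z J).
Proof. by rewrite -(mul0r (size J)%:Z); apply: wtv_mono => j; apply: wtv_u. Qed.

Lemma E1_Y J : E i1 (Y J) = 0.
Proof. by apply: opE_mono0 => j; rewrite opE_us // rows scale0r scaler0. Qed.

Lemma F1_Y J : F i1 (Y J) = 0.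
Proof. by apply: opF_mono0 => j; rewrite opF_us // rows scale0r scaler0. Qed.

Lemma E1_Z J : E i1 (Z J) = 0.
Proof. by apply: opE_mono0 => j; rewrite opE_u rows scale0r. Qed.

Lemma F1_Z J : F i1 (Z J) = 0.
Proof. by apply: opF_mono0 => j; rewrite opF_u rows scale0r. Qed.

End Words.

Section Bilinear.
Variables (K : fieldType) (B : algType K).
Implicit Types (T : B -> B -> B).

Definition bil T := (forall y, linear (T^~ y)) /\ (forall x, linear (T x)).

Lemma bil_mul (D D' : {linear B -> B}) : bil (fun x y => D x * D' y).
Proof.
split=> [y c a b|x c a b] /=; rewrite linearP.
  by rewrite mulrDl scalerAl.
by rewrite mulrDr scalerAr.
Qed.

Lemma bil_comb T T' c : bil T -> bil T' -> bil (fun x y => T x y - c *: T' x y).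
Proof.
move=> [Tl Tr] [Tl' Tr']; split=> [y k a b|x k a b].
  rewrite Tl Tl' scalerDr opprD addrACA scalerBr !scalerA [k * c]mulrC.
  by [].
rewrite Tr Tr' scalerDr opprD addrACA scalerBr !scalerA [k * c]mulrC.
by [].
Qed.

Lemma lspan_bil T P P' G : bil T ->
    (forall x y, P x -> P' y -> lspan G (T x y)) ->
  forall x y, lspan P x -> lspan P' y -> lspan G (T x y).
Proof.
move=> [Tl Tr] PG x y Px P'y.
have lin0 (f : B -> B) : linear f -> f 0 = 0.
  by move=> lf; have := lf (-1) 0 0; rewrite scaler0 addr0 scaleN1r addNr.
have linD (f : B -> B) : linear f -> forall a b, f (a + b) = f a + f b.
  by move=> lf a b; have := lf 1 a b; rewrite !scale1r.
have linZ (f : B -> B) : linear f -> forall c a, f (c *: a) = c *: f a.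
  by move=> lf c a; have := lf c a 0; rewrite !addr0 (lin0 f) // addr0.
elim: Px => [|{}x Px|a b _ IHa _ IHb|c a _ IH].
- by rewrite (lin0 (T^~ y)) //; apply: lspan0.
- elim: P'y => [|{}y P'y|a b _ IHa _ IHb|c a _ IH].
  + by rewrite (lin0 (T x)) //; apply: lspan0.
  + exact: PG.
  + by rewrite (linD (T x)) //; apply: lspanD.
  + by rewrite (linZ (T x)) //; apply: lspanZ.
- by rewrite (linD (T^~ y)) //; apply: lspanD.
- by rewrite (linZ (T^~ y)) //; apply: lspanZ.
Qed.

End Bilinear.

(** * Invariants of [U_q(su(2))] as combinations of words [Y N * Z M] *)

Section SU2Invariants.
Variables (R : realType) (q : R) (act : SUq3 q -> Uqsu3 q -> SUq3 q).
Hypotheses (q_gt0 : 0 < q) (q_lt1 : q < 1) (H : su3_action act).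
Local Open Scope complex_scope.
Local Notation A := (SUq3 q).
Local Notation C := R[i].
Local Notation Q := (q%:C : C).
Local Notation S := ((Num.sqrt q)%:C : C).
Local Notation u := (Agen_u q).
Local Notation us := (ustar q).
Local Notation K i := (op H (Ugen_K q i)).
Local Notation E i := (op H (Ugen_E q i)).
Local Notation F i := (op H (Ugen_F q i)).
Local Notation Y := (mono (us r2)).
Local Notation U1 := (mono (u r1)).
Local Notation U0 := (mono (u r0)).
Local Notation Z := (mono (u r2)).
Implicit Types a b x y : A.

Let q0 : q != 0. Proof. by rewrite gt_eqF. Qed.
Let Q0 : Q != 0. Proof. exact: Q_neq0. Qed.
Let SX0 n : S ^ n != 0. Proof. exact: (sqrtXz_neq0 q_gt0). Qed.

Lemma lspan_mul2 (P G : A -> Prop) b c : (forall y, P y -> lspan G (b * y * c)) ->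
  forall x, lspan P x -> lspan G (b * x * c).
Proof.
move=> PG x Px; rewrite -mulrA.
apply: lspan_mull (lspan_mulr (P' := fun z => exists2 y, P y & z = y * c) _ Px).
  by move=> _ [y Py ->]; rewrite mulrA; apply: PG.
by move=> y Py; apply: lspan_base; exists y.
Qed.

Lemma wt_U1 J : wtv H i1 (size J) (U1 J).
Proof. by rewrite -[Posz _]mul1r; apply: (wtv_mono q_gt0) => j; apply: wtv_u. Qed.

Lemma wt_U0 J : wtv H i1 (- (size J)%:Z) (U0 J).
Proof. by rewrite -mulN1r; apply: (wtv_mono q_gt0) => j; apply: wtv_u. Qed.

Lemma F1_U1 J : F i1 (U1 J) = 0.
Proof. by apply: opF_mono0 => j; rewrite opF_u rows scale0r. Qed.

Lemma E1_U0 J : E i1 (U0 J) = 0.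
Proof. by apply: opE_mono0 => j; rewrite opE_u rows scale0r. Qed.

Lemma E1_U1_gather J : lspan (fun x => exists J' k,
  size J = (size J').+1 /\ x = U1 J' * u r0 k) (E i1 (U1 J)).
Proof.
apply: (gatherR (opE1 H i1) (opE_mul H i1)).
- by move=> j; exists 1; rewrite opE_u !rows eqxx.
- exact: exch_u.
- by move=> j; eexists; apply: opK_u.
- by move=> J'; eexists; apply: (wtvL q_gt0 (wt_U1 J')).
Qed.

Lemma F1_U0_gather J : lspan (fun x => exists k J',
  size J = (size J').+1 /\ x = u r1 k * U0 J') (F i1 (U0 J)).
Proof.
apply: (gatherL (opF1 H i1) (opF_mul H i1)).
- by move=> j; exists 1; rewrite opF_u !rows eqxx.
- exact: exch_u.
- by move=> J'; eexists; apply: (wt_U0 J').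
- by move=> j; eexists; apply: (wtvL q_gt0 (wtv_u H i1 _ j)).
Qed.

(** The expression is bilinear, so it suffices to take [w = U1 J' * u^1_a] and [x = u^2_b * U0 I'].
    Then [F_1] and [E_1] swap the rows of the two inner letters, [c] normalizes the coefficient to
    [q], and [u01_comm] replaces the difference by an adjoint of some [z_k], which joins the prefix
    [Y N]. *)
Lemma su2_words_exchange (N J I M : seq 'I_3) w x : size J = size I ->
  lspan (fun x => exists J' k, size J = (size J').+1 /\ x = U1 J' * u r0 k) w ->
  lspan (fun x => exists k I', size I = (size I').+1 /\ x = u r1 k * U0 I') x ->
  let c := Q * (S ^ (size J).-1 * S ^ (size J).-1) in
  lspan (su2_words (size J).-1) (Y N * (w * x - c *: (F i1 w * E i1 x)) * Z M).
Proof.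
move=> JI Pw Px c.
apply: (lspan_mul2 (P := fun y => lspan (su2_words (size J).-1) (Y N * y * Z M))) => //.
have bT : bil (fun w x => w * x - c *: (F i1 w * E i1 x)).
  by apply: bil_comb; [apply: (bil_mul idfun idfun) | apply: bil_mul].
apply: (lspan_bil bT) Pw Px => {w x} _ _ [J' [a [sJ ->]]] [b [I' [sI ->]]].
have sJI : size J' = size I' by apply: succn_inj; rewrite -sJ -sI.
have -> : F i1 (U1 J' * u r0 a) = (S ^ size J')^-1 *: (U1 J' * u r1 a).
  rewrite opF_mul F1_U1 mul0r add0r (wtvL q_gt0 (wt_U1 J')) opF_u !rows eqxx.
  by rewrite scale1r scalerAl.
have -> : E i1 (u r1 b * U0 I') = (S ^ size J')^-1 *: (u r0 b * U0 I').
  rewrite opE_mul E1_U0 mulr0 addr0 (wt_U0 I') opE_u !rows eqxx.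
  by rewrite scale1r scalerAr -invr_expz sJI.
rewrite -scalerAl -scalerAr !scalerA.
have -> : c / S ^ size J' / S ^ size J' = Q.
  by rewrite /c sJ /= !mulrA !mulfK ?SX0.
rewrite -(mulrA (U1 J')) (mulrA (u r0 a)).
rewrite -[X in _ - _ *: X]mulrA (mulrA (u r1 a)).
have [d [k ->]] := u01_comm q0 a b.
rewrite mulrDl mulrDr -!scalerAl -!scalerAr addrAC subrr add0r.
apply: lspanZ; rewrite mulrA.
have e12 : exch (u r1) (us r2) by move=> ? ?; apply: u1_ustar2_comm.
apply: lspan_mulr (exch_mono e12 J' k) => _ [l [J'' [sJ'' ->]]].
apply: lspan_base; apply: lspan_base; exists (rcons N l), J'', I', M.
by rewrite sJ'' sJI sJ /= -sJI mono_rcons !mulrA.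
Qed.

(** Equal to [[h][h+1]], the value of [E_1 F_1] on weight zero in the representation of spin [h];
    this unsimplified form shows positivity. *)
Definition su2_eig (h : nat) : C :=
  (S ^ h)^-1 * (S ^ (2 - h%:Z) * (Q * (S ^ h.-1 * S ^ h.-1) * (qint q h * qint q h))
     + (S ^ h)^-1 * qint q h).

Lemma su2_eig_gt0 h : (0 < h)%N -> 0 < su2_eig h.
Proof.
move=> h0; have qh := qint_gt0 q_gt0 q_lt1 h0; have Sn n := sqrtXz_gt0 q_gt0 n.
rewrite /su2_eig mulr_gt0 ?invr_gt0 // addr_gt0 // ?mulr_gt0 ?invr_gt0 //.
exact: Q_gt0.
Qed.

Lemma su2_word (N J I M : seq 'I_3) : size J = size I ->
  let x := Y N * (U1 J * U0 I) * Z M in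
  lspan (su2_words (size J).-1) (E i1 (F i1 x) - su2_eig (size J) *: x).
Proof.
move=> JI x; rewrite /x {x}.
rewrite (E1F1_mulr _ (wt_Z q_gt0 H M) (E1_Z H M) (F1_Z H M)).
rewrite (E1F1_mull q_gt0 _ (wt_Y q_gt0 H N) (E1_Y q_gt0 H N) (F1_Y q_gt0 H N)).
set h := size J; set X := F i1 (U0 I); set W := E i1 (U1 J).
have FW : F i1 W = qint q h *: U1 J.
  by apply: (FE_wt q_gt0 (wt_U1 J)); apply: F1_U1.
have EX : E i1 X = qint q h *: U0 I.
  by rewrite /h JI; apply: (EF_wt q_gt0 (wt_U0 I)); apply: E1_U0.
have wX : wtv H i1 (2 - h%:Z) X.
  by rewrite addrC /h JI; apply: (wtvF q_gt0); apply: wt_U0.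
have -> : E i1 (F i1 (U1 J * U0 I)) =
    (S ^ h)^-1 *: (S ^ (2 - h%:Z) *: (W * X) + (S ^ h)^-1 *: (qint q h *: (U1 J * U0 I))).
  rewrite opF_mul F1_U1 mul0r add0r (wtvL q_gt0 (wt_U1 J)) -scalerAl linearZ /=.
  rewrite opE_mul -/X -/W wX (wtvL q_gt0 (wt_U1 J)) EX.
  by rewrite -scalerAr -!scalerAl -scalerAr.
have := su2_words_exchange N M JI (E1_U1_gather J) (F1_U0_gather I).
rewrite -/W -/X -/h FW EX /=; set c := Q * _.
(* The factor is the coefficient of [W * X] in [E_1 F_1 (U1 J * U0 I)]. *)
move=> /(lspanZ ((S ^ h)^-1 * S ^ (2 - h%:Z))).
have mZ k y : Y N * (k *: y) * Z M = k *: (Y N * y * Z M).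
  by rewrite -scalerAr -scalerAl.
have mD y z : Y N * (y + z) * Z M = Y N * y * Z M + Y N * z * Z M.
  by rewrite mulrDr mulrDl.
have mB y z : Y N * (y - z) * Z M = Y N * y * Z M - Y N * z * Z M.
  by rewrite mulrBr mulrBl.
rewrite -scalerAl -scalerAr !(mZ, mB, mD) scalerBr !scalerDr !scalerA.
congr lspan; rewrite -[RHS]addrA -[X in _ = _ + X]scalerBl -scaleNr; congr (_ + _ *: _).
by rewrite /su2_eig -/c; ring.
Qed.

Lemma realXz_inj (r : R) : 0 < r -> r < 1 -> injective (fun n : int => (r%:C : C) ^ n).
Proof.
move=> r0 r1 n m; rewrite -!fmorphXz => /fmorph_inj.
by apply: ieexprIz; rewrite ?lt_eqF.
Qed.

Lemma sqrtXz_inj : injective (fun n : int => S ^ n).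
Proof.
apply: realXz_inj; rewrite ?sqrtr_gt0 //.
by rewrite -[ltRHS]sqrtr1 ltr_sqrt.
Qed.

Lemma su2_words_le h h' : (h <= h')%N ->
  forall x, lspan (su2_words h) x -> lspan (su2_words h') x.
Proof.
move=> hh; apply: lspan_mono => x [N [J [I [M [JI Jh ->]]]]].
by exists N, J, I, M; split=> //; apply: leq_trans hh.
Qed.

(** [E_1 F_1] kills [x], yet acts on the top layer by the nonzero [su2_eig h.+1]; so [x] equals a
    combination of words of lower layers. *)
Lemma su2_descent h x : F i1 x = 0 -> lspan (su2_words h.+1) x ->
  lspan (su2_words h) x.
Proof.
move=> Fx Px.
suff : lspan (su2_words h) (E i1 (F i1 x) - su2_eig h.+1 *: x).
  rewrite Fx linear0 sub0r -scaleNr; apply: lspanZK.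
  by rewrite oppr_eq0 gt_eqF ?su2_eig_gt0.
elim: Px => {Fx x} [|x [N [J [I [M [JI Jh xE]]]]]|x y _ IHx _ IHy|c x _ IH].
- by rewrite !linear0 addr0; apply: lspan0.
- have Pw := su2_word N M JI; rewrite /= -xE in Pw.
  have [Jh1|Jh1] := eqVneq (size J) h.+1; first by rewrite Jh1 in Pw.
  have {Jh}Jh : (size J <= h)%N by rewrite -ltnS ltn_neqAle Jh1.
  have Px : lspan (su2_words h) x by apply: lspan_base; exists N, J, I, M.
  apply: lspanB (lspanZ _ Px); rewrite -[E _ _](subrK (su2_eig (size J) *: x)).
  apply: lspanD (lspanZ _ Px); apply: su2_words_le Pw.
  exact: leq_trans (leq_pred _) Jh.
- by rewrite [F i1 _]linearD [E i1 _]linearD /= scalerDr opprD addrACA; apply: lspanD.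
- rewrite [F i1 _]linearZ [E i1 _]linearZ /= scalerA mulrC -scalerA -scalerBr.
  exact: lspanZ.
Qed.

Lemma su2_invariants x : wtv H i1 0 x -> F i1 x = 0 ->
  lspan (fun y => exists N M, y = Y N * Z M) x.
Proof.
move=> Kx Fx.
pose P (n : int) y := exists N J I M,
  n = (size J)%:Z - (size I)%:Z /\ y = Y N * (U1 J * U0 I) * Z M.
have S_inj := sqrtXz_inj.
have PK n y : P n y -> K i1 y = S ^ n *: y.
  move=> [N [J [I [M [-> ->]]]]]; rewrite -/(wtv H i1 _ _).
  have := wtvM q_gt0 (wtvM q_gt0 (wt_Y q_gt0 H N)
    (wtvM q_gt0 (wt_U1 J) (wt_U0 I))) (wt_Z q_gt0 H M).
  by rewrite add0r addr0.
(* Weight zero leaves only words with as many letters [u^2] as [u^1]. *)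
have {}Px : lspan (P 0) x.
  apply: (lspan_eigen (linearP _) S_inj PK _ Kx).
  apply: lspan_mono (span_words q_gt0 x) => _ [J [I [M ->]]].
  exists ((size J)%:Z - (size I)%:Z), [::], J, I, M.
  by rewrite mono_nil mul1r.
have [h Ph] : exists h, lspan (su2_words h) x.
  elim: Px => [|y [N [J [I [M [JI yE]]]]]|y z _ [h Hh] _ [k Hk]|c y _ [h Hh]].
  - by exists 0%N; apply: lspan0.
  - exists (size J); apply: lspan_base; exists N, J, I, M; split=> //.
    by move/eqP: JI; rewrite eq_sym subr_eq0 eqz_nat => /eqP.
  - exists (maxn h k); apply: lspanD.
      exact: su2_words_le (leq_maxl h k) _ Hh.
    exact: su2_words_le (leq_maxr h k) _ Hk.
  - by exists h; apply: lspanZ.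
elim: h Ph => [|h IH] Ph; last exact/IH/su2_descent.
apply: lspan_mono Ph => _ [N [[|? ?] [[|? ?] [M [//= _ _ ->]]]]].
by exists N, M; rewrite !mono_nil !mulr1.
Qed.

End SU2Invariants.

(** * A Laplacian on the sphere, and vectors killed by [F_1] and [F_2] *)

Section LowestWeightVectors.
Variables (R : realType) (q : R) (act : SUq3 q -> Uqsu3 q -> SUq3 q).
Hypotheses (q_gt0 : 0 < q) (q_lt1 : q < 1) (H : su3_action act).
Local Open Scope complex_scope.
Local Notation A := (SUq3 q).
Local Notation C := R[i].
Local Notation Q := (q%:C : C).
Local Notation S := ((Num.sqrt q)%:C : C).
Local Notation u := (Agen_u q).
Local Notation us := (ustar q).
Local Notation K i := (op H (Ugen_K q i)).
Local Notation E i := (op H (Ugen_E q i)).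
Local Notation F i := (op H (Ugen_F q i)).
Local Notation Y := (mono (us r2)).
Local Notation Z := (mono (u r2)).
Implicit Types a b x y : A.

Let q0 : q != 0. Proof. by rewrite gt_eqF. Qed.
Let Q0 : Q != 0. Proof. exact: Q_neq0. Qed.
Let SX0 n : S ^ n != 0. Proof. exact: (sqrtXz_neq0 q_gt0). Qed.

Lemma qint1 : qint q 1 = 1.
Proof.
have := qint_gt0 q_gt0 q_lt1 (isT : 0 < 1)%N; rewrite /qint /qnum expr1.
by have [->|d0 _] := eqVneq (q - q^-1) 0; rewrite ?mul0r ?ltxx // divff.
Qed.

Lemma wt2_Y J : wtv H i2 (- (size J)%:Z) (Y J).
Proof. by rewrite -mulN1r; apply: (wtv_mono q_gt0) => j; apply: (wtv_us q_gt0). Qed.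

Lemma wt2_Z J : wtv H i2 (size J) (Z J).
Proof. by rewrite -[Posz _]mul1r; apply: (wtv_mono q_gt0) => j; apply: wtv_u. Qed.

Lemma E2_Y J : E i2 (Y J) = 0.
Proof. by apply: opE_mono0 => j; rewrite opE_us // rows scale0r scaler0. Qed.

Lemma F2_Z J : F i2 (Z J) = 0.
Proof. by apply: opF_mono0 => j; rewrite opF_u rows scale0r. Qed.

Lemma F2_Y_gather J : lspan (fun x => exists J' k,
  size J = (size J').+1 /\ x = Y J' * us r1 k) (F i2 (Y J)).
Proof.
apply: (gatherR (opF1 H i2) (opF_mul H i2)).
- by move=> j; exists (- Q^-1); rewrite opF_us // !rows eqxx scale1r.
- exact: exch_us.
- by move=> j; eexists; apply: (wtv_us q_gt0).
- by move=> J'; eexists; apply: (wtvL q_gt0 (wt2_Y J')).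
Qed.

Lemma E2_Z_gather J : lspan (fun x => exists k J',
  size J = (size J').+1 /\ x = u r1 k * Z J') (E i2 (Z J)).
Proof.
apply: (gatherL (opE1 H i2) (opE_mul H i2)).
- by move=> j; exists 1; rewrite opE_u !rows eqxx.
- exact: exch_u.
- by move=> J'; eexists; apply: (wt2_Z J').
- by move=> j; eexists; apply: (wtvL q_gt0 (wtv_u H i2 _ j)).
Qed.

Definition sph_words (n m : nat) x := exists N M,
  [/\ size M = (size N + n)%N, (size N <= m)%N & x = Y N * Z M].

(** On spanning pairs the three products have the rows 2, 1 and 3 of [u] in the middle, and the
    constants bring all coefficients to 1. So [column_rel] collapses their sum to [Y N' * Z M'] or
    to 0, which removes one letter on each side. *)
Lemma sph_words_exchange n (N M : seq 'I_3) w x : size M = (size N + n)%N ->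
  lspan (fun x => exists N' k, size N = (size N').+1 /\ x = Y N' * us r1 k) w ->
  lspan (fun x => exists k M', size M = (size M').+1 /\ x = u r1 k * Z M') x ->
  let c := Q^-1 * (S ^ (size N).-1 * S ^ (size M).-1)^-1 in
  lspan (sph_words n (size N).-1)
    (w * x - Q *: (F i1 w * E i1 x) - c *: (E i2 w * F i2 x)).
Proof.
move=> MN Pw Px c.
have bT : bil (fun w x => w * x - Q *: (F i1 w * E i1 x) - c *: (E i2 w * F i2 x)).
  by apply: bil_comb; [apply: bil_comb; [apply: (bil_mul idfun idfun)|] |]; apply: bil_mul.
apply: (lspan_bil bT) Pw Px => {w x} _ _ [N' [a [sN ->]]] [b [M' [sM ->]]].
have sMN : size M' = (size N' + n)%N by apply: succn_inj; rewrite -sM MN sN addSn.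
have -> : F i1 (Y N' * us r1 a) = - Q^-1 *: (Y N' * us r0 a).
  rewrite opF_mul F1_Y // mul0r add0r (wtvL q_gt0 (wt_Y q_gt0 H N')) opF_us //.
  by rewrite !rows eqxx scale1r expr0z invr1 scale1r -scalerAr.
have -> : E i1 (u r1 b * Z M') = u r0 b * Z M'.
  rewrite opE_mul E1_Z mulr0 addr0 (wt_Z q_gt0 H M') opE_u !rows eqxx.
  by rewrite scale1r expr0z scale1r.
have -> : E i2 (Y N' * us r1 a) = (- Q * S ^ size N') *: (Y N' * us r2 a).
  rewrite opE_mul E2_Y mul0r add0r (wtvL q_gt0 (wt2_Y N')) opE_us //.
  by rewrite !rows eqxx scale1r -scalerAr -scalerAl invr_expz opprK scalerA.
have -> : F i2 (u r1 b * Z M') = S ^ size M' *: (u r2 b * Z M').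
  rewrite opF_mul F2_Z mulr0 addr0 (wt2_Z M') opF_u !rows eqxx.
  by rewrite scale1r scalerAr.
rewrite -!scalerAl -!scalerAr !scalerA.
have -> : Q * - Q^-1 = -1 by rewrite mulrN mulfV.
have -> : c * (- Q * S ^ size N') * S ^ size M' = -1.
  by rewrite /c sM sN /=; field; rewrite ?Q0 ?SX0.
rewrite !scaleN1r !opprK -!(mulrA (Y N')) -!mulrDr !(mulrA _ _ (Z M')) -!mulrDl.
have := column_rel q0 a b; rewrite !big_ord_recl big_ord0 addr0.
rewrite (_ : lift ord0 (lift ord0 ord0) = r2); last exact: val_inj.
rewrite addrA [us r0 a * _ + _]addrC => ->.
case: eqP => _; last by rewrite mul0r mulr0; apply: lspan0.
by rewrite mul1r; apply: lspan_base; exists N', M'; rewrite sN.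
Qed.

(* With this t, the cross terms of lap (Y N * Z M) form the                   *)
(* U_q(su(2))-invariant combination to which column_rel applies.              *)
Let t : C := - Q / (1 + Q ^+ 2).

Definition lap x := E i2 (F i2 x) + t *: E i1 (E i2 (F i1 (F i2 x))).

Fact lap_linear : linear lap.
Proof.
by move=> c x y; rewrite /lap !linearP /= addrACA scalerDr.
Qed.
HB.instance Definition _ := GRing.isLinear.Build C A A *:%R lap lap_linear.

(** Equal to [[m][m+n+2]/[2]], a q-analogue of a Laplace eigenvalue on the projective plane. *)
Definition sph_eig (n m : nat) : C :=
  let M := (m + n)%N in
  S ^ M * (qint q m * S ^ M + (S ^ (- m%:Z + 2))^-1 / (1 + Q ^+ 2) *
     (Q^-1 * (S ^ m.-1 * S ^ M.-1)^-1 * (qint q m * qint q M))).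

Let Q21_gt0 : 0 < 1 + Q ^+ 2.
Proof. by rewrite addr_gt0 ?exprn_gt0 ?Q_gt0. Qed.

Lemma sph_eig_gt0 n m : (0 < m)%N -> 0 < sph_eig n m.
Proof.
move=> m0; have qm := qint_gt0 q_gt0 q_lt1 m0; have Sn k := sqrtXz_gt0 q_gt0 k.
have qM : 0 < qint q (m + n) by apply: qint_gt0; rewrite ?addn_gt0 ?m0.
rewrite /sph_eig mulr_gt0 // addr_gt0 ?mulr_gt0 ?invr_gt0 //.
- exact: Q_gt0.
- by rewrite mulr_gt0.
Qed.

Lemma sph_word n (N M : seq 'I_3) : size M = (size N + n)%N ->
  let x := Y N * Z M in
  lspan (sph_words n (size N).-1) (lap x - sph_eig n (size N) *: x).
Proof.
move=> MN x; set m := size N in MN *.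
set Y' := F i2 (Y N); set X' := E i2 (Z M).
have EY : E i2 Y' = qint q m *: Y N.
  by apply: (EF_wt q_gt0 (wt2_Y N)); apply: E2_Y.
have FX : F i2 X' = qint q (m + n) *: Z M.
  by rewrite -MN; apply: (FE_wt q_gt0 (wt2_Z M)); apply: F2_Z.
have wY' : wtv H i2 (- m%:Z + 2) Y' by apply: (wtvF q_gt0); apply: wt2_Y.
have wY1' : wtv H i1 (-1) Y'.
  by rewrite -[-1]add0r; apply: (wtvF' q_gt0) => //; apply: wt_Y.
pose Y'' := F i1 Y'.
have wY'' : wtv H i2 (- m%:Z + 2 - 1) Y'' by apply: (wtvF' q_gt0).
have wY1'' : wtv H i1 1 Y'' by apply: (wtvF q_gt0 wY1').
have EY'' : E i2 Y'' = 0.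
  by rewrite -(EFcomm' H) // EY linearZ /= F1_Y // scaler0.
have E1Y' : E i1 Y' = 0 by rewrite /Y' -(EFcomm' H) // E1_Y // linear0.
have E1Y'' : E i1 Y'' = Y'.
  by rewrite (EF_wt q_gt0 (n := 1)) // qint1 scale1r.
have wX : wtv H i1 1 X'.
  by rewrite -[1]add0r; apply: (wtvE' q_gt0) => //; apply: wt_Z.
have F2x : F i2 x = S ^ (m + n)%N *: (Y' * Z M).
  by rewrite /x opF_mul F2_Z mulr0 addr0 (wt2_Z M) MN -scalerAr.
have F1Y'Z : F i1 (Y' * Z M) = Y'' * Z M.
  by rewrite opF_mul F1_Z mulr0 addr0 (wt_Z q_gt0 H M) expr0z scale1r.
have E2Y'Z : E i2 (Y' * Z M) = (qint q m * S ^ (m + n)%N) *: x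
    + (S ^ (- m%:Z + 2))^-1 *: (Y' * X').
  rewrite opE_mul EY (wt2_Z M) MN (wtvL q_gt0 wY').
  by rewrite -!scalerAl -scalerAr scalerA.
have E2Y''Z : E i2 (Y'' * Z M) = ((S ^ (- m%:Z + 2))^-1 * S) *: (Y'' * X').
  rewrite opE_mul EY'' mul0r add0r (wtvL q_gt0 wY'') -scalerAl.
  by congr (_ *: _); rewrite expfzDr ?sqrt_neq0 // invfM exprN1 invrK.
have E1Y''X : E i1 (Y'' * X') = S *: (Y' * X') + S^-1 *: (Y'' * E i1 X').
  by rewrite opE_mul E1Y'' wX (wtvL q_gt0 wY1'') -scalerAl -scalerAr.
have := sph_words_exchange MN (F2_Y_gather N) (E2_Z_gather M).
rewrite -/Y' -/X' EY FX -/Y'' /= MN -scalerAl -scalerAr scalerA -/m.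
set c := Q^-1 / _; rewrite -/x.
(* This is the coefficient of [Y' * X'] in [lap x]; that of [Y'' * E_1 X'] is [-q] times it, as the
   exchange lemma requires. *)
move=> /(lspanZ (S ^ (m + n)%N * ((S ^ (- m%:Z + 2))^-1 / (1 + Q ^+ 2)))).
have -> : lap x = S ^ (m + n)%N *: E i2 (Y' * Z M)
    + (t * S ^ (m + n)%N) *: E i1 (E i2 (F i1 (Y' * Z M))).
  rewrite /lap F2x -scalerA; congr (_ + _ *: _); first by rewrite linearZ.
  by rewrite [F i1 _]linearZ [E i2 _]linearZ [E i1 _]linearZ.
rewrite F1Y'Z E2Y'Z E2Y''Z [E i1 (_ *: _)]linearZ /= E1Y''X.
congr lspan.
rewrite !scalerBr !scalerDr !scalerA.
rewrite /sph_eig -/c.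
set v := (S ^ (- m%:Z + 2))^-1; set s := S ^ (m + n)%N.
set e := (s * (qint q m * s)) *: x; rewrite -(addrA e) (addrA ((s * v) *: _)).
rewrite [e + _]addrC -[RHS]addrA /e -scalerDl -[X in _ = _ + X]scalerBl -!scaleNr.
have Q2 : 1 + Q ^+ 2 != 0 by rewrite gt_eqF.
have QS : Q = S ^+ 2 by apply: QE.
have S0 : S != 0 by apply: sqrt_neq0.
congr (_ *: _ + _ *: _ + _ *: _); rewrite ?/t ?[in LHS]/GRing.scale ?[in RHS]/GRing.scale /=.
- by rewrite QS; field; rewrite -QS.
- by rewrite QS; field; rewrite -QS S0 Q2.
- by ring.
Qed.

Lemma sph_words_le n m m' : (m <= m')%N ->
  forall x, lspan (sph_words n m) x -> lspan (sph_words n m') x.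
Proof.
move=> mm; apply: lspan_mono => x [N [M [MN Nm ->]]].
by exists N, M; split=> //; apply: leq_trans mm.
Qed.

Lemma sph_descent n m x : F i2 x = 0 -> lspan (sph_words n m.+1) x ->
  lspan (sph_words n m) x.
Proof.
move=> Fx Px.
suff : lspan (sph_words n m) (lap x - sph_eig n m.+1 *: x).
  rewrite /lap Fx !linear0 !add0r -scaleNr; apply: lspanZK.
  by rewrite oppr_eq0 gt_eqF ?sph_eig_gt0.
elim: Px => {Fx x} [|x [N [M [MN Nm xE]]]|x y _ IHx _ IHy|c x _ IH].
- by rewrite !linear0 addr0; apply: lspan0.
- have Pw := sph_word MN; rewrite /= -xE in Pw.
  have [Nm1|Nm1] := eqVneq (size N) m.+1; first by rewrite Nm1 in Pw.
  have {Nm}Nm : (size N <= m)%N by rewrite -ltnS ltn_neqAle Nm1.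
  have Px : lspan (sph_words n m) x by apply: lspan_base; exists N, M.
  apply: lspanB (lspanZ _ Px); rewrite -[lap _](subrK (sph_eig n (size N) *: x)).
  apply: lspanD (lspanZ _ Px); apply: sph_words_le Pw.
  exact: leq_trans (leq_pred _) Nm.
- by rewrite [lap _]linearD /= scalerDr opprD addrACA; apply: lspanD.
- rewrite [lap _]linearZ /= scalerA mulrC -scalerA -scalerBr.
  exact: lspanZ.
Qed.

Lemma lowest_weight_vectors n x :
    wtv H i1 0 x -> F i1 x = 0 -> F i2 x = 0 -> K i2 (K i2 x) = Q ^ n%:Z *: x ->
  lspan (fun y => exists2 M, size M = n & y = Z M) x.
Proof.
move=> Kx F1x F2x K2x.
pose P (k : int) y := exists N M, k = (size M)%:Z - (size N)%:Z /\ y = Y N * Z M.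
have PK k y : P k y -> K i2 (K i2 y) = Q ^ k *: y.
  move=> [N [M [-> ->]]].
  set k' : int := _ - _; set y' := _ * _.
  have wy : K i2 y' = S ^ k' *: y'.
    by rewrite /k' [_ - _]addrC; apply: (wtvM q_gt0 (wt2_Y N) (wt2_Z M)).
  have -> : Q ^ k' = S ^ k' * S ^ k' by rewrite QE // expr2 expfzMl.
  by rewrite wy linearZ /= wy scalerA.
have linT : linear (fun y => K i2 (K i2 y)) by move=> c y z; rewrite !linearP.
have {}Px : lspan (P n) x.
  apply: (lspan_eigen linT (realXz_inj q_gt0 q_lt1) PK _ K2x).
  apply: lspan_mono (su2_invariants q_gt0 q_lt1 Kx F1x) => _ [N [M ->]].
  by exists ((size M)%:Z - (size N)%:Z), N, M.
have [m Pm] : exists m, lspan (sph_words n m) x.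
  elim: Px => [|y [N [M [MN yE]]]|y z _ [h Hh] _ [k Hk]|c y _ [h Hh]].
  - by exists 0%N; apply: lspan0.
  - exists (size N); apply: lspan_base; exists N, M; split=> //.
    by apply/eqP; rewrite -eqz_nat PoszD MN addrC subrK.
  - exists (maxn h k); apply: lspanD.
      exact: sph_words_le (leq_maxl h k) _ Hh.
    exact: sph_words_le (leq_maxr h k) _ Hk.
  - by exists h; apply: lspanZ.
elim: m Pm => [|m IH] Pm; last exact/IH/sph_descent.
apply: lspan_mono Pm => _ [[|? ?] [M [//= MN _ ->]]].
by exists M; rewrite // mono_nil mul1r.
Qed.
End LowestWeightVectors.

(** * The connection *)

Section QuantumSpace.
Variables (K : fieldType) (B : algType K) (c : K) (z : 'I_3 -> B).
Hypothesis c0 : c != 0.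
Hypothesis zC : forall i j : 'I_3, (i < j)%N -> z i * z j = c *: (z j * z i).

Definition mono3 j k l := z (inord 0) ^+ j * z (inord 1) ^+ k * z (inord 2) ^+ l.

Lemma qcommX (i j : 'I_3) n : (i < j)%N ->
  z j * z i ^+ n = c ^- n *: (z i ^+ n * z j).
Proof.
move=> ij; elim: n => [|n IH]; first by rewrite !expr0 invr1 scale1r mulr1 mul1r.
have step : z j * z i = c^-1 *: (z i * z j) by rewrite (zC ij) scalerA mulVf ?scale1r.
rewrite [z i ^+ _]exprS mulrA step -scalerAl -(mulrA _ (z j)) IH -scalerAr scalerA.
by rewrite mulrA [c ^+ n.+1]exprS invfM. 
Qed.

Lemma mono3_mul0 j k l : z (inord 0) * mono3 j k l = mono3 j.+1 k l.
Proof. by rewrite /mono3 exprS !mulrA. Qed.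

Lemma mono3_mul1 j k l : z (inord 1) * mono3 j k l = c ^- j *: mono3 j k.+1 l.
Proof.
rewrite /mono3 !mulrA qcommX ?inordK // exprS -!scalerAl.
by rewrite !mulrA.
Qed.

Lemma mono3_mul2 j k l : z (inord 2) * mono3 j k l = c ^- (j + k) *: mono3 j k l.+1.
Proof.
rewrite /mono3 !mulrA qcommX ?inordK // -!scalerAl -(mulrA _ (z (inord 2))).
rewrite qcommX ?inordK // -scalerAr -scalerAl scalerA -invfM -exprD addnC.
by rewrite exprS !mulrA.
Qed.

End QuantumSpace.

(** * q-trinomial sums over the simplex [j + k + l = N] *)

Section Sum3.
Variable V : nmodType.
Implicit Types (h : nat -> nat -> nat -> V).

Definition sum3 a b c h := \sum_(j < a) \sum_(k < b) \sum_(l < c) h j k l.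

Lemma sum3_shift0 a b c h :
  sum3 a.+1 b c (fun j k l => if j is j'.+1 then h j' k l else 0) = sum3 a b c h.
Proof.
by rewrite /sum3 big_ord_recl /= big1 ?add0r // => k _; rewrite big1.
Qed.

Lemma sum3_shift1 a b c h :
  sum3 a b.+1 c (fun j k l => if k is k'.+1 then h j k' l else 0) = sum3 a b c h.
Proof.
by apply: eq_bigr => j _; rewrite big_ord_recl /= big1 ?add0r.
Qed.

Lemma sum3_shift2 a b c h :
  sum3 a b c.+1 (fun j k l => if l is l'.+1 then h j k l' else 0) = sum3 a b c h.
Proof.
by do 2![apply: eq_bigr => ? _]; rewrite big_ord_recl /= add0r.
Qed.

Lemma sum3_trunc0 a b c h : (forall k l, h a k l = 0) ->
  sum3 a.+1 b c h = sum3 a b c h.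
Proof.
move=> h0; rewrite /sum3 big_ord_recr /= [X in _ + X]big1 ?addr0 // => k _.
by rewrite big1.
Qed.

Lemma sum3_trunc1 a b c h : (forall j l, h j b l = 0) ->
  sum3 a b.+1 c h = sum3 a b c h.
Proof.
move=> h0; apply: eq_bigr => j _; rewrite big_ord_recr /= [X in _ + X]big1 ?addr0 //.
Qed.

Lemma sum3_trunc2 a b c h : (forall j k, h j k c = 0) ->
  sum3 a b c.+1 h = sum3 a b c h.
Proof.
by move=> h0; do 2![apply: eq_bigr => ? _]; rewrite big_ord_recr /= h0 addr0.
Qed.

Definition level N h j k l := if (j + k + l == N)%N then h j k l else 0.

(** Summation form of a Pascal rule: each of the three predecessor terms is shifted back to level
    [N], and the larger box adds only zero entries. *)
Lemma sum3_level N h h0 h1 h2 :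
    (forall j k l, (j + k + l = N.+1)%N -> h j k l =
       (if j is j'.+1 then h0 j' k l else 0) + (if k is k'.+1 then h1 j k' l else 0)
       + (if l is l'.+1 then h2 j k l' else 0)) ->
  sum3 N.+2 N.+2 N.+2 (level N.+1 h) = sum3 N.+1 N.+1 N.+1
    (level N (fun j k l => h0 j k l + h1 j k l + h2 j k l)).
Proof.
move=> hE.
have levelN f j k l : (N < j + k + l)%N -> level N f j k l = 0.
  by move=> Nj; rewrite /level gtn_eqF.
transitivity (sum3 N.+2 N.+2 N.+2 (fun j k l => if j is j'.+1 then level N h0 j' k l else 0)
   + sum3 N.+2 N.+2 N.+2 (fun j k l => if k is k'.+1 then level N h1 j k' l else 0)
   + sum3 N.+2 N.+2 N.+2 (fun j k l => if l is l'.+1 then level N h2 j k l' else 0)).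
  rewrite -!big_split; apply: eq_bigr => j _; rewrite -!big_split; apply: eq_bigr => k _.
  rewrite -!big_split; apply: eq_bigr => l _ /=.
  move: (nat_of_ord j) (nat_of_ord k) (nat_of_ord l) => {}j {}k {}l; rewrite /level.
  case: eqP => [e|ne].
    rewrite hE //; congr (_ + _ + _).
    - by case: j e => // j e; case: eqP => // ?; lia.
    - by case: k e => // k e; case: eqP => // ?; lia.
    - by case: l e => // l e; case: eqP => // ?; lia.
  rewrite [X in _ = X + _ + _](_ : _ = 0); last first.
    by case: j ne => // j ne; case: eqP => // ?; lia.
  rewrite [X in _ = _ + X + _](_ : _ = 0); last first.
    by case: k ne => // k ne; case: eqP => // ?; lia.
  rewrite [X in _ = _ + X](_ : _ = 0) ?addr0 //.
  by case: l ne => // l ne; case: eqP => // ?; lia.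
rewrite sum3_shift0 sum3_shift1 sum3_shift2.
have T0 f b c : sum3 N.+2 b c (level N f) = sum3 N.+1 b c (level N f).
  by apply: sum3_trunc0 => *; apply: levelN; lia.
have T1 f a c : sum3 a N.+2 c (level N f) = sum3 a N.+1 c (level N f).
  by apply: sum3_trunc1 => *; apply: levelN; lia.
have T2 f a b : sum3 a b N.+2 (level N f) = sum3 a b N.+1 (level N f).
  by apply: sum3_trunc2 => *; apply: levelN; lia.
rewrite !(T0, T1, T2).
rewrite -!big_split; apply: eq_bigr => j _; rewrite -!big_split; apply: eq_bigr => k _.
rewrite -!big_split; apply: eq_bigr => l _ /=; rewrite /level.
by case: ifP; rewrite ?addr0.
Qed.

End Sum3.

Section QTrinomial.
Variables (R : realType) (q : R).
Hypotheses (q_gt0 : 0 < q) (q_lt1 : q < 1).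

Lemma qnum_gt0 n : (0 < n)%N -> 0 < qnum q n.
Proof. by move=> n0; rewrite -ltcR; apply: (qint_gt0 q_gt0 q_lt1). Qed.

Lemma qfactS n : qfact q n.+1 = qfact q n * qnum q n.+1.
Proof. by rewrite /qfact big_nat_recr. Qed.

Lemma qfact_gt0 n : 0 < qfact q n.
Proof.
elim: n => [|n IH]; first by rewrite /qfact big_nil.
by rewrite qfactS mulr_gt0 ?qnum_gt0.
Qed.

Lemma qtrinom_gt0 j k l : 0 < qtrinom q j k l.
Proof.
by rewrite /qtrinom !(mulr_gt0, invr_gt0, exprn_gt0, qfact_gt0).
Qed.

(** A q-Pascal rule. Each summand is a fraction of [qtrinom q j k l], and [key], a splitting of
    [[j + k + l]], says that the fractions add up to 1. *)
Lemma qtrinom_rec j k l : (0 < j + k + l)%N -> qtrinom q j k l =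
  (if j is j'.+1 then qtrinom q j' k l else 0)
  + (if k is k'.+1 then q ^- j * q ^- j * qtrinom q j k' l else 0)
  + (if l is l'.+1 then q ^- (j + k) * q ^- (j + k) * qtrinom q j k l' else 0).
Proof.
move=> n0; have qn := qnum_gt0 n0.
have q0 : q != 0 by rewrite gt_eqF.
have f0 n : qfact q n != 0 by rewrite gt_eqF ?qfact_gt0.
have d0 n : qnum q n.+1 != 0 by rewrite gt_eqF ?qnum_gt0.
(* At [m = 0] the default value 0 of the match agrees with [[0] = 0]. *)
have E0 m (f : nat -> R) : (forall m', m = m'.+1 ->
    f m' = qtrinom q j k l * (q ^+ (j + k + l) / q ^+ m * qnum q m) / qnum q (j + k + l)) ->
    (if m is m'.+1 then f m' else 0) =
    qtrinom q j k l * (q ^+ (j + k + l) / q ^+ m * qnum q m) / qnum q (j + k + l).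
  case: m => [|m] Hm; last exact: Hm.
  by rewrite /qnum expr0 invr1 subrr !mul0r !mulr0 mul0r.
have nz := (d0, f0, expf_neq0, q0).
rewrite (E0 j (fun j' => qtrinom q j' k l)); last first.
  move=> j' jE; rewrite jE /qtrinom !addSn !qfactS.
  have -> : (j'.+1 * k + k * l + l * j'.+1 = (j' * k + k * l + l * j') + (k + l))%N by lia.
  by rewrite !exprS !exprD; field; rewrite !nz.
have -> : (if k is k'.+1 then q ^- j * q ^- j * qtrinom q j k' l else 0) =
    q ^- j * q ^- j * (if k is k'.+1 then qtrinom q j k' l else 0).
  by case: (k); rewrite // mulr0.
rewrite (E0 k (fun k' => qtrinom q j k' l)); last first.
  move=> k' kE; rewrite kE /qtrinom !addnS !addSn !qfactS.
  have -> : (j * k'.+1 + k'.+1 * l + l * j = (j * k' + k' * l + l * j) + (j + l))%N by lia.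
  by rewrite !exprS !exprD; field; rewrite !nz.
have -> : (if l is l'.+1 then q ^- (j + k) * q ^- (j + k) * qtrinom q j k l' else 0) =
    q ^- (j + k) * q ^- (j + k) * (if l is l'.+1 then qtrinom q j k l' else 0).
  by case: (l); rewrite // mulr0.
rewrite (E0 l (fun l' => qtrinom q j k l')); last first.
  move=> l' lE; rewrite lE /qtrinom !addnS !qfactS.
  have -> : (j * k + k * l'.+1 + l'.+1 * j = (j * k + k * l' + l' * j) + (j + k))%N by lia.
  by rewrite !exprS !exprD; field; rewrite !nz.
have n1 : qnum q (j + k + l) != 0 by rewrite gt_eqF.
have d1 : q - q^-1 != 0.
  by apply: contra_neq n1 => d; rewrite /qnum d invr0 mulr0.
pose a m := q ^+ (j + k + l) / q ^+ m * qnum q m.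
have key : qnum q (j + k + l) = a j + q ^- j * q ^- j * a k
    + q ^- (j + k) * q ^- (j + k) * a l.
  have q2 : q ^+ 2 - 1 != 0.
    by rewrite (_ : _ - 1 = q * (q - q^-1)) ?mulf_neq0 //; field.
  by rewrite /a /qnum !exprD; field; rewrite !nz -?expr2 ?q2.
rewrite -/(a j) -/(a k) -/(a l) -[LHS](mulfK n1) {1}key.
by field; rewrite ?n1 !nz.
Qed.

End QTrinomial.

(** * [Psi_N] has norm one, and the connection reduces to [F_2] *)

Section Sphere.
Variables (R : realType) (q : R) (act : SUq3 q -> Uqsu3 q -> SUq3 q).
Hypotheses (q_gt0 : 0 < q) (q_lt1 : q < 1) (H : su3_action act).
Local Open Scope complex_scope.
Local Notation A := (SUq3 q).
Local Notation C := R[i].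
Local Notation Q := (q%:C : C).
Local Notation S := ((Num.sqrt q)%:C : C).
Local Notation u := (Agen_u q).
Local Notation us := (ustar q).
Local Notation K i := (op H (Ugen_K q i)).
Local Notation L i := (op H (pgen _ (UKinv i))).
Local Notation F i := (op H (Ugen_F q i)).
Local Notation z3 := (mono3 (u r2)).
Implicit Types a b x y : A.

Let q0 : q != 0. Proof. by rewrite gt_eqF. Qed.
Let Q0 : Q != 0. Proof. exact: Q_neq0. Qed.

Let zz j k l : A := z3 j k l * (pstar (z3 j k l) : A).

Let zC (i j : 'I_3) : (i < j)%N -> u r2 i * u r2 j = Q *: (u r2 j * u r2 i).
Proof. exact: u_row. Qed.

(* The sum for N + 1 is \sum_i z_i s z_i^*, with s the sum for N.              *)
Lemma sphere_sum N :
  sum3 N.+1 N.+1 N.+1 (level N (fun j k l => (qtrinom q j k l)%:C *: zz j k l)) = 1.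
Proof.
elim: N => [|N IH].
  rewrite /sum3 !big_ord1 /level /= /zz /mono3 !expr0 !mulr1 pstar1 mulr1.
  rewrite /qtrinom !mul0n !addn0 expr0 invr1 mul1r /qfact !big_nil.
  by rewrite !mulr1 invr1 mulr1 scale1r.
have assoc4 a b x y : a * (b * x) * y = a * b * (x * y) by rewrite !mulrA.
have h0 j k l : zz j.+1 k l = u r2 (inord 0) * zz j k l * us r2 (inord 0).
  by rewrite /zz -mono3_mul0 pstarM pstar_u [RHS]assoc4.
have h1 j k l : (q ^- j * q ^- j)%:C *: zz j k.+1 l
    = u r2 (inord 1) * zz j k l * us r2 (inord 1).
  rewrite /zz -pstar_u [RHS]assoc4 -pstarM (mono3_mul1 Q0 zC).
  rewrite pstarZ -scalerAl -scalerAr scalerA; congr (_ *: _).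
  by rewrite rmorphM fmorphV rmorphXn /= -rmorphXn -fmorphV conj_real.
have h2 j k l : (q ^- (j + k) * q ^- (j + k))%:C *: zz j k l.+1
    = u r2 (inord 2) * zz j k l * us r2 (inord 2).
  rewrite /zz -pstar_u [RHS]assoc4 -pstarM (mono3_mul2 Q0 zC).
  rewrite pstarZ -scalerAl -scalerAr scalerA; congr (_ *: _).
  by rewrite rmorphM fmorphV rmorphXn /= -rmorphXn -fmorphV conj_real.
rewrite (sum3_level (h0 := fun j k l => (qtrinom q j k l)%:C *: zz j.+1 k l)
  (h1 := fun j k l => (qtrinom q j k l)%:C *: ((q ^- j * q ^- j)%:C *: zz j k.+1 l))
  (h2 := fun j k l => (qtrinom q j k l)%:C *:
           ((q ^- (j + k) * q ^- (j + k))%:C *: zz j k l.+1))); last first.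
  move=> j k l jkl; rewrite (qtrinom_rec q_gt0 q_lt1) ?jkl // !rmorphD /= !scalerDl.
  congr (_ + _ + _).
  - by case: j jkl => // *; rewrite scale0r.
  - by case: k jkl => [|k] *; rewrite ?scale0r // scalerA [X in X%:C *: _]mulrC rmorphM.
  - by case: l jkl => [|l] *; rewrite ?scale0r // scalerA [X in X%:C *: _]mulrC rmorphM.
have step i : u r2 i * us r2 i = u r2 i * sum3 N.+1 N.+1 N.+1
    (level N (fun j k l => (qtrinom q j k l)%:C *: zz j k l)) * us r2 i.
  by rewrite IH mulr1.
rewrite -[RHS](sphere_rel q0) !big_ord_recl big_ord0 addr0 !step addrA.
have t0 : inord 0 = ord0 :> 'I_3 by apply: val_inj; rewrite /= inordK.
have t1 : inord 1 = lift ord0 ord0 :> 'I_3 by apply: val_inj; rewrite /= inordK.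
have t2 : inord 2 = lift ord0 (lift ord0 ord0) :> 'I_3.
  by apply: val_inj; rewrite /= inordK.
rewrite t0 in h0; rewrite t1 in h1; rewrite t2 in h2.
rewrite /sum3 !mulr_sumr !mulr_suml -!big_split; apply: eq_bigr => j _.
rewrite !mulr_sumr !mulr_suml -!big_split; apply: eq_bigr => k _.
rewrite !mulr_sumr !mulr_suml -!big_split; apply: eq_bigr => l _ /=.
rewrite /level; case: ifP => _; last by rewrite !mulr0 !mul0r !addr0.
by rewrite h0 h1 h2 -!scalerAr -!scalerAl.
Qed.

Lemma sum_level N (f : nat -> nat -> nat -> A) :
  \sum_(n : 'I_N.+1 * 'I_N.+1 * 'I_N.+1 | (n.1.1 + n.1.2 + n.2 == N)%N)
    f n.1.1 n.1.2 n.2 = sum3 N.+1 N.+1 N.+1 (level N f).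
Proof.
rewrite big_mkcond /=.
rewrite -(pair_bigA _ (fun (p : 'I_N.+1 * 'I_N.+1) (l : 'I_N.+1) =>
  if (p.1 + p.2 + l == N)%N then f p.1 p.2 l else 0)) /=.
by rewrite -(pair_bigA _ (fun (j k : 'I_N.+1) => \sum_(l < N.+1)
  if (j + k + l == N)%N then f j k l else 0)).
Qed.

Lemma psi_sum N :
  \sum_(n : 'I_N.+1 * 'I_N.+1 * 'I_N.+1 | (n.1.1 + n.1.2 + n.2 == N)%N)
    (pstar (psi q n.1.1 n.1.2 n.2) : A) * psi q n.1.1 n.1.2 n.2 = 1.
Proof.
rewrite -[RHS](sphere_sum N) -sum_level; apply: eq_bigr => n _.
have sq (r : R) m : 0 <= r -> (pstar (pstar ((Num.sqrt r)%:C *: m) : A) : A)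
    * (pstar ((Num.sqrt r)%:C *: m) : A) = r%:C *: (m * (pstar m : A)).
  move=> r0; rewrite pstarK pstarZ conj_real -scalerAl -scalerAr scalerA.
  by rewrite -rmorphM -expr2 sqr_sqrtr.
exact/sq/ltW/(qtrinom_gt0 q_gt0 q_lt1).
Qed.

Lemma wtv_pstar i n a : wtv H i n a -> L i (pstar a) = S ^ n *: (pstar a : A).
Proof.
move=> Ka; have := act_star H a (Var (UK i)); rewrite /= (pstar_pcls _ UstarK) /=.
rewrite -[act a _]/(K i a) Ka pstarZ => e; rewrite /op -[LHS]e.
by rewrite -fmorphXz conj_real.
Qed.

Section Nabla.
Variable N : nat.
Local Notation bigN F := (\sum_(n : 'I_N.+1 * 'I_N.+1 * 'I_N.+1 |
  (n.1.1 + n.1.2 + n.2 == N)%N) F n).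
Let ps (n : 'I_N.+1 * 'I_N.+1 * 'I_N.+1) := psi q n.1.1 n.1.2 n.2.

Lemma psiF i n : F i (pstar (ps n)) = 0.
Proof.
rewrite /ps /psi pstarK linearZ /=.
have Fz j : F i (u r2 j) = 0.
  rewrite opF_u; case: eqP => [/(congr1 val) /= e|]; last by rewrite scale0r.
  by have := ltn_ord i; rewrite -e.
have FX j k : F i (u r2 j ^+ k) = 0.
  elim: k => [|k IH]; first by rewrite expr0 opF1.
  by rewrite exprS opF_mul Fz IH mul0r mulr0 addr0.
by rewrite !opF_mul !FX !(mulr0, mul0r, addr0) scaler0.
Qed.

Lemma psi_wt1 n : wtv H i1 0 (pstar (ps n)).
Proof.
rewrite /ps /psi pstarK; apply: wtvZ.
have X j k : wtv H i1 0 (u r2 j ^+ k).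
  elim: k => [|k IH]; first exact: wtv1.
  by rewrite exprS; apply: (wtvM q_gt0 (wtv_u H i1 r2 j) IH).
by apply: (wtvM q_gt0 (wtvM q_gt0 (X _ _) (X _ _)) (X _ _)).
Qed.

Lemma psi_wt2 (n : 'I_N.+1 * 'I_N.+1 * 'I_N.+1) : (n.1.1 + n.1.2 + n.2 == N)%N -> wtv H i2 N (pstar (ps n)).
Proof.
move=> /eqP nN; rewrite /ps /psi pstarK; apply: wtvZ.
have X j (k : nat) : wtv H i2 k (u r2 j ^+ k).
  elim: k => [|k IH]; first exact: wtv1.
  by rewrite exprS; apply: (wtvM q_gt0 (wtv_u H i2 r2 j) IH).
by rewrite -{1}nN; apply: (wtvM q_gt0 (wtvM q_gt0 (X _ _) (X _ _)) (X _ _)).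
Qed.

(** Apply [F_2] to [psi_sum]: it kills the adjoint entries, on which [K_2^-1] acts by one common
    nonzero scalar. *)
Lemma psi_sumF2 : bigN (fun n => (pstar (ps n) : A) * F i2 (ps n)) = 0.
Proof.
have := opF1 H i2; rewrite -(psi_sum N) linear_sum /=.
rewrite (eq_bigr (fun n => (S ^ N)^-1 *: ((pstar (ps n) : A) * F i2 (ps n)))); last first.
  move=> n nN; rewrite -/(ps n) opF_mul psiF mul0r add0r.
  by rewrite (wtvL q_gt0 (psi_wt2 nN)) scalerAl.
rewrite -scaler_sumr => /eqP; rewrite scaler_eq0 invr_eq0.
by rewrite (negPf (sqrtXz_neq0 q_gt0 _)) => /eqP.
Qed.

Lemma psi_sumF1F2 : bigN (fun n => (pstar (ps n) : A) * F i1 (F i2 (ps n))) = 0.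
Proof.
have e := congr1 (F i1) psi_sumF2; rewrite linear0 linear_sum /= in e.
rewrite -[RHS]e; apply: eq_bigr => n nN; rewrite opF_mul psiF mul0r add0r.
by rewrite (wtvL q_gt0 (psi_wt1 n)) expr0z invr1 scale1r.
Qed.

Lemma nabla_dbarE x : nabla_dbar act N x = Q ^- N *:
  (bigN (fun n => (pstar (ps n) : A) * F i1 (F i2 (ps n * x))),
   bigN (fun n => (pstar (ps n) : A) * F i2 (ps n * x))).
Proof.
rewrite /nabla_dbar; congr (_ *: _).
rewrite /dbar /=; under eq_bigr => n _ do rewrite -/(ps n) (act_comp H).
by apply: (big_rec3 (fun a b s => s = (a, b))) => // n a b s _ ->.
Qed.

(** In the Leibniz rule the terms with [F_2] on [Psi_N] cancel by [psi_sumF2], and the others add up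
    by [psi_sum]. *)
Lemma nabla_snd x : bigN (fun n => (pstar (ps n) : A) * F i2 (ps n * x)) = S ^ N *: F i2 x.
Proof.
rewrite (eq_bigr (fun n => (pstar (ps n) : A) * F i2 (ps n) * K i2 x +
    S ^ N *: ((pstar (ps n) : A) * ps n * F i2 x))); last first.
  move=> n nN; rewrite opF_mul -[X in L i2 X](pstarK (ps n)).
  by rewrite (wtv_pstar (psi_wt2 nN)) pstarK mulrDr -scalerAl -scalerAr !mulrA.
rewrite big_split /= -mulr_suml psi_sumF2 mul0r add0r -scaler_sumr -mulr_suml.
by rewrite psi_sum mul1r.
Qed.

Lemma nabla_dbar_eq0 x : F i1 x = 0 -> nabla_dbar act N x = 0 <-> F i2 x = 0.
Proof.
move=> F1x; rewrite nabla_dbarE nabla_snd; split=> [/(congr1 snd)/= /eqP|F2x].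
  rewrite !scaler_eq0 invr_eq0 expf_eq0 (negPf Q0) andbF.
  by rewrite (negPf (sqrtXz_neq0 q_gt0 _)) => /eqP.
(* With [F_1] and [F_2] both killing [x], every derivative in the first component falls on [Psi_N],
   where [psi_sumF1F2] applies. *)
rewrite F2x scaler0 (eq_bigr (fun n => (pstar (ps n) : A) * F i1 (F i2 (ps n))
    * K i1 (K i2 x))); last first.
  move=> n _; rewrite opF_mul F2x mulr0 addr0 opF_mul -mulrA.
  have : K i2 (F i1 x) = 0 by rewrite F1x linear0.
  rewrite (KFcomm' H) // => /eqP; rewrite scaler_eq0 invr_eq0.
  by rewrite (negPf (sqrt_neq0 q_gt0)) => /eqP->; rewrite mulr0 addr0.
by rewrite -mulr_suml psi_sumF1F2 mul0r scaler0.
Qed.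

End Nabla.
End Sphere.

(** * Holomorphic sections as words in the [z_j] *)

Section HolomorphicSections.
Variables (R : realType) (q : R) (act : SUq3 q -> Uqsu3 q -> SUq3 q).
Hypotheses (q_gt0 : 0 < q) (q_lt1 : q < 1) (H : su3_action act).
Local Open Scope complex_scope.
Local Notation A := (SUq3 q).
Local Notation C := R[i].
Local Notation Q := (q%:C : C).
Local Notation u := (Agen_u q).
Local Notation K i := (op H (Ugen_K q i)).
Local Notation L i := (op H (pgen _ (UKinv i))).
Local Notation E i := (op H (Ugen_E q i)).
Local Notation F i := (op H (Ugen_F q i)).
Local Notation Z := (mono (u r2)).
Implicit Types a b x y : A.

Lemma in_S5E x : K i1 x = x -> E i1 x = 0 -> F i1 x = 0 -> in_S5 act x.
Proof.
move=> Kx Ex Fx t; rewrite -[act _ _]/(op H _ _).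
have Lx : L i1 x = x by rewrite -{1}Kx LK.
elim: t => [g|c|s IHs t IHt|s IHs t IHt].
- rewrite /Ucounit; case: g => i /= /eqP ->; rewrite ?scale1r ?scale0r.
  + exact: Kx.
  + exact: Lx.
  + exact: Ex.
  + exact: Fx.
- move=> _; rewrite /Ucls pcls_cst op_scale /Ucounit /=.
  by rewrite /op (act_id H) /GRing.scale /= mulr1.
- move=> /= /andP[/IHs xs /IHt xt]; rewrite /Ucls pclsD op_add.
  by rewrite -!/(Ucls q _) xs xt -scalerDl.
- move=> /= /andP[/IHs xs /IHt xt]; rewrite /Ucls pclsM opM.
  by rewrite -!/(Ucls q _) xs linearZ /= xt scalerA.
Qed.

Lemma hol_sectionP N x : hol_section act N x <->
  lspan (fun y => exists2 M, size M = N & y = Z M) x.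
Proof.
split=> [[[xS5 xN] nab0]|Px].
  have Kx : wtv H i1 0 x.
    by have := xS5 (Var (UK i1)) isT; rewrite /wtv expr0z; apply.
  have Fx : F i1 x = 0.
    by have := xS5 (Var (UF i1)) isT; rewrite /Ucounit /= scale0r; apply.
  apply: (lowest_weight_vectors q_gt0 q_lt1 Kx Fx).
    exact/(nabla_dbar_eq0 q_gt0 q_lt1 N Fx).
  rewrite -xN -[act x _]/(op H _ x) expr2 !opM.
  by rewrite [K i1 x]Kx expr0z scale1r.
(* Each condition defining a holomorphic section becomes an eigenvector equation, which is tested on
   the spanning words. *)
have spanZ (f : A -> A) c : linear f -> (forall M, size M = N -> f (Z M) = c *: Z M) ->
    f x = c *: x.
  move=> lf fZ; apply/eqP; rewrite -subr_eq0; apply/eqP.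
  apply: (lspan_eq0 (f := fun y => f y - c *: y)) Px => [k y z|_ [M sM ->]].
    rewrite lf scalerDr !scalerBr !scalerA opprD addrACA [c * k]mulrC.
    by [].
  by rewrite fZ // subrr.
have Kx : K i1 x = x.
  rewrite -[RHS]scale1r; apply: spanZ => [|M _]; first exact: linearP.
  by rewrite [LHS](wt_Z q_gt0 H M) expr0z.
have Ex : E i1 x = 0.
  rewrite -[RHS](scale0r x); apply: spanZ => [|M _]; first exact: linearP.
  by rewrite E1_Z scale0r.
have Fx : F i1 x = 0.
  rewrite -[RHS](scale0r x); apply: spanZ => [|M _]; first exact: linearP.
  by rewrite F1_Z scale0r.
have F2x : F i2 x = 0.
  rewrite -[RHS](scale0r x); apply: spanZ => [|M _]; first exact: linearP.
  by rewrite F2_Z scale0r.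
have K2x : K i2 (K i2 x) = Q ^ N%:Z *: x.
  apply: (spanZ (fun y => K i2 (K i2 y))) => [k y z|M sM]; first by rewrite !linearP.
  have wZ := wt2_Z q_gt0 H M; rewrite [K i2 (Z M)]wZ linearZ /= wZ scalerA sM.
  by rewrite (QE q_gt0) expr2 expfzMl.
split; last exact/(nabla_dbar_eq0 q_gt0 q_lt1 N Fx).
split; first exact: in_S5E.
by rewrite -[act x _]/(op H _ x) expr2 !opM Kx K2x.
Qed.

End HolomorphicSections.

(** * Linear independence of the monomials in z *)

Section Functionals.
Variables (R : realType) (q : R) (act : SUq3 q -> Uqsu3 q -> SUq3 q).
Hypotheses (q_gt0 : 0 < q) (q_lt1 : q < 1) (H : su3_action act).
Local Open Scope complex_scope.
Local Notation A := (SUq3 q).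
Local Notation C := R[i].
Local Notation S := ((Num.sqrt q)%:C : C).
Local Notation u := (Agen_u q).
Local Notation E i := (op H (Ugen_E q i)).
Implicit Types a b : nat.
Implicit Types x y : A.

Definition counit x : C := Acounit (repr x).

Lemma counit_pcls t : counit (pcls _ t) = Acounit t.
Proof. apply: teval_tcong (@Aq_rel_counit R q) _ _ (repr_pcls _ _). Qed.

Lemma counitM x y : counit (x * y) = counit x * counit y.
Proof.
by elim/palg_ind: x => s; elim/palg_ind: y => t; rewrite -pclsM !counit_pcls.
Qed.

Lemma counitD x y : counit (x + y) = counit x + counit y.
Proof.
by elim/palg_ind: x => s; elim/palg_ind: y => t; rewrite -pclsD !counit_pcls.
Qed.

Lemma counitZ c x : counit (c *: x) = c * counit x.
Proof.
elim/palg_ind: x => s; rewrite -pclsZ !counit_pcls /Acounit /=.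
by rewrite /GRing.scale /= mulr1.
Qed.

Lemma counit0 : counit 0 = 0.
Proof. by rewrite -(scale0r (0 : A)) counitZ mul0r. Qed.

Lemma counit1 : counit 1 = 1.
Proof. by rewrite -pcls1 counit_pcls /Acounit /= scale1r. Qed.

Lemma counit_u i j : counit (u i j) = (i == j)%:R.
Proof. by rewrite counit_pcls. Qed.

Lemma wtv_iterE i n y a : wtv H i n y -> wtv H i (n - 2 * a%:Z) (iter a (E i) y).
Proof.
move=> yn; elim: a => [|a IH] /=; first by rewrite mulr0 subr0.
rewrite (_ : n - _ = n - 2 * a%:Z - 2); last lia.
exact: (wtvE q_gt0).
Qed.

Lemma wt_hi i : wt i (row_hi i) = 1.
Proof. by rewrite /wt eqxx -val_eqE /= /bump /= gtn_eqF. Qed.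

Lemma wt_lo i : wt i (row_lo i) = -1.
Proof. by rewrite /wt eqxx -val_eqE /= /bump /= ltn_eqF // sub0r. Qed.

(** [E_i] sends row [row_hi i] to [row_lo i] and kills the latter, so at most one of the [a]
    operators hits the last letter. The coefficients are sums of positive terms, and only their sign
    matters later. *)
Lemma iterE_hi i n y c a : wtv H i n y -> exists mu nu : C, [/\ 0 < mu, 0 < nu &
  iter a (E i) (y * u (row_hi i) c) = mu *: (iter a (E i) y * u (row_hi i) c)
    + (if a is a'.+1 then nu *: (iter a' (E i) y * u (row_lo i) c) else 0)].
Proof.
move=> yn; have Sn k := sqrtXz_gt0 q_gt0 k.
have Ehi x m : wtv H i m x -> E i (x * u (row_hi i) c) =
    S *: (E i x * u (row_hi i) c) + (S ^ m)^-1 *: (x * u (row_lo i) c).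
  move=> xm; rewrite opE_mul opE_u eqxx scale1r opK_u wt_hi expr1z.
  by rewrite (wtvL q_gt0 xm) -scalerAl -scalerAr.
have Elo x : E i (x * u (row_lo i) c) = S^-1 *: (E i x * u (row_lo i) c).
  rewrite opE_mul opE_u opK_u wt_lo exprN1 -scalerAr.
  rewrite -val_eqE /= /bump /= ltn_eqF // scale0r mulr0 addr0.
  by [].
elim: a => [|a [mu [nu [mu0 nu0 IH]]]].
  by exists 1, 1; rewrite ltr01 scale1r addr0.
case: a IH => [|a] /= IH.
  exists (mu * S), (mu * (S ^ n)^-1); split; rewrite ?mulr_gt0 ?invr_gt0 ?sqrt_gt0 //.
  by rewrite IH addr0 linearZ /= (Ehi _ _ yn) scalerDr !scalerA.
have wa := wtv_iterE a.+1 yn; rewrite /= in wa.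
exists (mu * S), (mu * (S ^ (n - 2 * a.+1%:Z))^-1 + nu * S^-1); split.
- by rewrite mulr_gt0 ?sqrt_gt0.
- by rewrite addr_gt0 ?mulr_gt0 ?invr_gt0 ?sqrt_gt0.
rewrite IH linearD /= !linearZ /= (Ehi _ _ wa) Elo scalerDr !scalerA scalerDl.
by rewrite addrA.
Qed.

Definition pairing a b x : C := counit (iter b (E i1) (iter a (E i2) x)).

Lemma iterD i b x y : iter b (E i) (x + y) = iter b (E i) x + iter b (E i) y.
Proof. by elim: b => //= b ->; rewrite linearD. Qed.

Lemma iterZ i b c x : iter b (E i) (c *: x) = c *: iter b (E i) x.
Proof. by elim: b => //= b ->; rewrite linearZ. Qed.

Lemma pairingD a b x y : pairing a b (x + y) = pairing a b x + pairing a b y.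
Proof. by rewrite /pairing !iterD counitD. Qed.

Lemma pairingZ a b c x : pairing a b (c *: x) = c * pairing a b x.
Proof. by rewrite /pairing !iterZ counitZ. Qed.

Lemma pairing0 a b : pairing a b 0 = 0.
Proof. by rewrite -(scale0r (0 : A)) pairingZ mul0r. Qed.

Lemma iterE_r2 b x c : iter b (E i1) (x * u r2 c) = iter b (E i1) x * u r2 c.
Proof.
elim: b => //= b ->; rewrite opE_mul opE_u !rows scale0r mulr0 addr0.
by rewrite opK_u expr0z scale1r.
Qed.

(* The counit kills u^i_j unless i = j, so only the terms in which z_j = u^3_j  *)
(* has been moved to u^j_j survive.                                           *)
Lemma pairing_mulz (n1 n2 : int) y c a b : wtv H i1 n1 y -> wtv H i2 n2 y ->
  exists2 k : C, 0 < k & pairing a b (y * u r2 c) = k *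
    (if c == r2 then pairing a b y
     else if c == r1 then (if a is a'.+1 then pairing a' b y else 0)
     else if a is a'.+1 then if b is b'.+1 then pairing a' b' y else 0 else 0).
Proof.
move=> w1 w2; have := iterE_hi c a w2; rewrite !rows => -[mu [nu [mu0 nu0 e]]].
rewrite /pairing e iterD iterZ iterE_r2 counitD counitZ counitM counit_u.
case: a e => [|a] _.
  have -> : iter b (E i1) 0 = 0 by elim: b => //= b ->; rewrite linear0.
  rewrite counit0 addr0; exists mu => //.
  by rewrite [r2 == c]eq_sym; do 2?case: eqP => // _; rewrite ?mulr1 ?mulr0.
have wa : wtv H i1 (n1 + a%:Z) (iter a (E i2) y).
  elim: (a) => [|d IH] /=; first by rewrite addr0.
  rewrite (_ : n1 + _ = n1 + d%:Z + 1); last lia.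
  exact: (wtvE' q_gt0).
have := iterE_hi c b wa; rewrite !rows => -[mu' [nu' [mu'0 nu'0 e]]].
rewrite iterZ counitZ e counitD counitZ counitM counit_u.
elim/ord3_ind: c e => /= _; rewrite ?mulr0n ?mulr1n ?mulr0 ?mulr1 ?add0r.
- case: b => [|b]; first by exists 1; rewrite ?counit0 // !mulr0.
  exists (nu * nu'); first exact: mulr_gt0.
  by rewrite counitZ counitM counit_u eqxx mulr1 mulrA.
- exists (nu * mu'); first exact: mulr_gt0.
  rewrite -mulrA; congr (_ * _).
  by case: b => [|b]; rewrite ?counit0 ?addr0 // counitZ counitM counit_u !mulr0 addr0.
- exists mu => //.
  by case: b => [|b]; rewrite ?counit0 ?mulr0 ?addr0 // counitZ counitM counit_u !mulr0 addr0.
Qed.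

(** Letters are peeled off from the right by [pairing_mulz]: [z_1] uses up one [E_2] and one [E_1],
    [z_2] one [E_2], and [z_3] nothing. So all operators are spent exactly when [a = j + k] and
    [b = j]. *)
Lemma pairing_mono3 j k l a b : exists2 c : C, 0 < c &
  pairing a b (mono3 (u r2) j k l) = c * ((a == j + k) && (b == j))%N%:R.
Proof.
have t0 : inord 0 = r0 by apply: val_inj; rewrite /= inordK.
have t1 : inord 1 = r1 by apply: val_inj; rewrite /= inordK.
have t2 : inord 2 = r2 by apply: val_inj; rewrite /= inordK.
have wX i c n : wtv H i (n%:Z * wt i r2) (u r2 c ^+ n).
  elim: n => [|n IH]; first by rewrite mul0r; apply: wtv1.
  by rewrite exprS -add1n PoszD mulrDl mul1r; apply: (wtvM q_gt0 (wtv_u H i r2 c) IH).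
have wm i j' k' l' := wtvM q_gt0 (wtvM q_gt0 (wX i (inord 0) j') (wX i (inord 1) k'))
  (wX i (inord 2) l').
elim: l => [|l [c c0 IH]]; last first.
  have -> : mono3 (u r2) j k l.+1 = mono3 (u r2) j k l * u r2 r2.
    by rewrite /mono3 exprSr t2 mulrA.
  have [d d0 ->] := pairing_mulz r2 a b (wm i1 j k l) (wm i2 j k l).
  by rewrite eqxx IH; exists (d * c); rewrite ?mulrA // mulr_gt0.
elim: k a => [|k IHk] a; last first.
  have -> : mono3 (u r2) j k.+1 0 = mono3 (u r2) j k 0 * u r2 r1.
    by rewrite /mono3 !expr0 !mulr1 exprSr t1 mulrA.
  have [d d0 ->] := pairing_mulz r1 a b (wm i1 j k 0%N) (wm i2 j k 0%N).
  rewrite /=; case: a => [|a]; first by exists 1; rewrite // addnS /= mulr0n !mulr0.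
  have [c c0 ->] := IHk a; exists (d * c); first exact: mulr_gt0.
  by rewrite mulrA addnS eqSS.
elim: j a b => [|j IHj] a b; last first.
  have -> : mono3 (u r2) j.+1 0 0 = mono3 (u r2) j 0 0 * u r2 r0.
    by rewrite /mono3 !expr0 !mulr1 exprSr t0.
  have [d d0 ->] := pairing_mulz r0 a b (wm i1 j 0%N 0%N) (wm i2 j 0%N 0%N).
  rewrite /=; case: a => [|a]; first by exists 1; rewrite //= mulr0n !mulr0.
  case: b => [|b]; first by exists 1; rewrite // andbF mulr0n !mulr0.
  have [c c0 ->] := IHj a b; exists (d * c); first exact: mulr_gt0.
  by rewrite mulrA addSn !eqSS.
exists 1; rewrite // mul1r /mono3 !expr0 !mulr1 /pairing.
case: a => [|a]; last first.
  have -> : iter a.+1 (E i2) 1 = 0 by elim: a => /= [|a ->]; rewrite ?opE1 ?linear0.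
  have -> : iter b (E i1) 0 = 0 by elim: b => //= b ->; rewrite linear0.
  by rewrite counit0.
case: b => [|b]; first by rewrite counit1.
have -> : iter b.+1 (E i1) 1 = 0 by elim: b => /= [|b ->]; rewrite ?opE1 ?linear0.
by rewrite counit0.
Qed.

End Functionals.

(* palg_universal needs a K-algebra as its target, whereas {poly B} is        *)
(* declared as an algebra over B only.                                        *)
Section PolyAlgebra.
Variables (K : fieldType) (B : algType K).

Definition polyalg : Type := {poly B}.
HB.instance Definition _ := GRing.NzRing.on polyalg.

Definition pa_scale (c : K) (p : polyalg) : polyalg := (c%:A : B) *: (p : {poly B}).

Fact pa_scaleA c d p : pa_scale c (pa_scale d p) = pa_scale (c * d) p.
Proof. by rewrite /pa_scale scalerA -scalerAl mul1r scalerA. Qed.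

Fact pa_scale1 : left_id 1 pa_scale.
Proof. by move=> p; rewrite /pa_scale !scale1r. Qed.

Fact pa_scaleDr : right_distributive pa_scale +%R.
Proof. by move=> c p r; rewrite /pa_scale scalerDr. Qed.

Fact pa_scaleDl p : {morph pa_scale^~ p : c d / c + d}.
Proof. by move=> c d; rewrite /pa_scale !scalerDl. Qed.

HB.instance Definition _ := GRing.Zmodule_isLmodule.Build K polyalg
  pa_scaleA pa_scale1 pa_scaleDr pa_scaleDl.

Fact pa_scaleAl (c : K) (p r : polyalg) : c *: (p * r) = (c *: p) * r.
Proof. exact: (@scalerAl B {poly B}). Qed.

HB.instance Definition _ := GRing.Lmodule_isLalgebra.Build K polyalg pa_scaleAl.

Fact pa_scaleAr (c : K) (p r : polyalg) : c *: (p * r) = p * (c *: r).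
Proof.
rewrite -[LHS]/((c%:A : B) *: ((p : {poly B}) * r)).
rewrite -[c *: r]/((c%:A : B) *: (r : {poly B})).
rewrite -!mul_polyC !mulrA; congr (_ * _).
apply/polyP => i; rewrite coefCM coefMC.
by rewrite mulr_algl mulr_algr.
Qed.

HB.instance Definition _ := GRing.Lalgebra_isAlgebra.Build K polyalg pa_scaleAr.

End PolyAlgebra.

(** * The coordinate ring *)

Section CoordinateRing.
Variables (R : realType) (q : R) (act : SUq3 q -> Uqsu3 q -> SUq3 q).
Hypotheses (q_gt0 : 0 < q) (q_lt1 : q < 1) (H : su3_action act).
Local Open Scope complex_scope.
Local Notation A := (SUq3 q).
Local Notation C := R[i].
Local Notation Q := (q%:C : C).
Local Notation u := (Agen_u q).
Local Notation Z := (mono (u r2)).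

Definition zq (i : 'I_3) : qplane q := pgen _ i.

Lemma zq_comm (i j : 'I_3) : (i < j)%N -> zq i * zq j = Q *: (zq j * zq i).
Proof.
by move=> ij; rewrite /zq /pgen -!pclsM -pclsZ; apply/pclsP/tc_rel/qplane_comm.
Qed.

Lemma qplane_span (x : qplane q) :
  lspan (fun y => exists j k l, y = mono3 zq j k l) x.
Proof.
have Q0 : Q != 0 by apply: Q_neq0; rewrite gt_eqF.
pose W (y : qplane q) := exists j k l, y = mono3 zq j k l.
suff P t y : lspan W y -> lspan W ((pcls _ t : qplane q) * y).
  rewrite -[x]mulr1; elim/palg_ind: x => t; apply/P/lspan_base.
  by exists 0%N, 0%N, 0%N; rewrite /mono3 !expr0 !mulr1.
have t0 : inord 0 = r0 by apply: val_inj; rewrite /= inordK.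
have t1 : inord 1 = r1 by apply: val_inj; rewrite /= inordK.
have t2 : inord 2 = r2 by apply: val_inj; rewrite /= inordK.
elim: t y => [i|c|s IHs t IHt|s IHs t IHt] y Wy.
- rewrite -[pcls _ _]/(zq i).
  apply: lspan_mull Wy => _ [j [k [l ->]]]; elim/ord3_ind: i.
  + by rewrite -t0 mono3_mul0; apply: lspan_base; exists j.+1, k, l.
  + by rewrite -t1 (mono3_mul1 Q0 zq_comm); apply/lspanZ/lspan_base; exists j, k.+1, l.
  + by rewrite -t2 (mono3_mul2 Q0 zq_comm); apply/lspanZ/lspan_base; exists j, k, l.+1.
- by rewrite pcls_cst -scalerAl mul1r; apply: lspanZ.
- by rewrite pclsD mulrDl; apply: lspanD; [apply: IHs | apply: IHt].
- by rewrite pclsM -mulrA; apply/IHs/IHt.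
Qed.

Lemma polyX_mul (a b : A) m n :
  (a%:P * 'X^m) * (b%:P * 'X^n) = (a * b)%:P * 'X^(m + n).
Proof.
by rewrite polyCM exprD -!mulrA; congr (_ * _); rewrite !mulrA (commr_polyXn b%:P).
Qed.

Lemma polyX_mul1 (a b : A) n :
  (a%:P * 'X) * (b%:P * 'X^n) = (a * b)%:P * 'X^(n.+1).
Proof. exact: (polyX_mul a b 1 n). Qed.

Let f (i : 'I_3) : polyalg A := (u r2 i)%:P * 'X.

Lemma qplane_morphism : exists phi : {rmorphism qplane q -> {poly A}},
  (forall (c : C) x, phi (c *: x) = c%:A *: phi x) /\
  (forall i, phi (zq i) = (u r2 i)%:P * 'X).
Proof.
have frel s t : qplane_rel q s t -> teval f s = teval f t.
  case=> i j ij /=; rewrite /f mulr_algl.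
  have e : (u r2 i)%:P * 'X * ((u r2 j)%:P * 'X) =
      (Q%:A : A) *: ((u r2 j)%:P * 'X * ((u r2 i)%:P * 'X)).
    rewrite (polyX_mul1 _ _ 1) (polyX_mul1 _ _ 1) -mul_polyC mulrA -polyCM mulr_algl.
    by rewrite (u_row q r2 ij).
  exact: e.
have [[phi [phiZ phiz]] _] := palg_universal frel.
by exists phi; split=> [c x|i]; [exact: phiZ | exact: phiz].
Qed.

Section Phi.
Variable phi : {rmorphism qplane q -> {poly A}}.
Hypothesis phiZ : forall (c : C) x, phi (c *: x) = c%:A *: phi x.
Hypothesis phiz : forall i, phi (zq i) = (u r2 i)%:P * 'X.

Lemma phiX i n : phi (zq i ^+ n) = (u r2 i ^+ n)%:P * 'X^n.
Proof.
elim: n => [|n IH]; first by rewrite !expr0 rmorph1 mulr1.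
by rewrite [zq i ^+ _]exprS rmorphM IH phiz polyX_mul1 -exprS.
Qed.

Lemma phi_mono3 j k l :
  phi (mono3 zq j k l) = (mono3 (u r2) j k l)%:P * 'X^(j + k + l).
Proof. by rewrite /mono3 !(rmorphM phi) !phiX !polyX_mul. Qed.

Lemma phi_mono J : phi (mono zq J) = (Z J)%:P * 'X^(size J).
Proof.
elim: J => [|j J IH]; first by rewrite !mono_nil rmorph1 mulr1.
by rewrite !mono_cons rmorphM IH phiz polyX_mul1.
Qed.

Lemma phi_coefZ c x n : (phi (c *: x))`_n = c *: (phi x)`_n.
Proof. by rewrite phiZ coefZ mulr_algl. Qed.

(** The pairing determines [j] and [k]; the power of [X] then determines [l]. *)
Let dual j k l x : C := pairing H (j + k) j (phi x)`_(j + k + l).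
Let coord j k l x : qplane q :=
  (dual j k l x / dual j k l (mono3 zq j k l)) *: mono3 zq j k l.

Let dualZD j k l c x y : dual j k l (c *: x + y) = c * dual j k l x + dual j k l y.
Proof. by rewrite /dual rmorphD coefD phi_coefZ pairingD pairingZ. Qed.

Let coordZD j k l c x y : coord j k l (c *: x + y) = c *: coord j k l x + coord j k l y.
Proof. by rewrite /coord dualZD mulrDl scalerDl scalerA mulrA. Qed.

Let dual_mono3 j k l : dual j k l (mono3 zq j k l) != 0.
Proof.
rewrite /dual phi_mono3 coefCM coefXn eqxx mulr1.
have [c c0 ->] := pairing_mono3 q_gt0 q_lt1 H j k l (j + k) j.
by rewrite !eqxx mulr1 gt_eqF.
Qed.

Let dual_mono3' j k l j' k' l' : (j, k, l) != (j', k', l') ->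
  dual j k l (mono3 zq j' k' l') = 0.
Proof.
move=> ne; rewrite /dual phi_mono3 coefCM coefXn.
have [en|] := eqVneq (j + k + l)%N; last by rewrite mulr0 pairing0.
rewrite mulr1; have [c _ ->] := pairing_mono3 q_gt0 q_lt1 H j' k' l' (j + k) j.
case: andP => [[/eqP e1 /eqP e2]|]; last by rewrite mulr0.
by case/eqP: ne; congr (_, _, _); lia.
Qed.

(** Expansion of [x] in the monomials through their dual functionals. All larger bounds are allowed
    so that two summands can share one. *)
Lemma qplane_coord x : exists M, forall M', (M <= M')%N ->
  x = sum3 M' M' M' (fun j k l => coord j k l x).
Proof.
have coord0 j k l : coord j k l 0 = 0.
  have := coordZD j k l (-1) 0 0.
  by rewrite scaler0 addr0 scaleN1r addNr.
elim: (qplane_span x) => {x} [|_ [j [k [l ->]]]|x y _ [m IHx] _ [n IHy]|c x _ [m IH]].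
- by exists 0%N => M _; rewrite /sum3; do 3![rewrite big1 // => ? _].
- exists (maxn j (maxn k l)).+1 => M; rewrite !gtn_max => /and3P[jM kM lM].
  pose T := mono3 zq j k l.
  have z j' k' l' : (j, k, l) != (j', k', l') -> coord j' k' l' T = 0.
    rewrite eq_sym => ne; rewrite /coord /T (dual_mono3' ne).
    by rewrite mul0r scale0r.
  rewrite /sum3 (bigD1 (Ordinal jM)) //= [X in _ + X]big1 ?addr0; last first.
    move=> j' jj'; do 2![rewrite big1 // => ? _]; apply: z.
    by apply: contraNneq jj' => -[e _ _]; apply/eqP/val_inj.
  rewrite (bigD1 (Ordinal kM)) //= [X in _ + X]big1 ?addr0; last first.
    move=> k' kk'; rewrite big1 // => ? _; apply: z.
    by apply: contraNneq kk' => -[e _]; apply/eqP/val_inj.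
  rewrite (bigD1 (Ordinal lM)) //= [X in _ + X]big1 ?addr0; last first.
    move=> l' ll'; apply: z.
    by apply: contraNneq ll' => -[e]; apply/eqP/val_inj.
  by rewrite /coord divff ?dual_mono3 // scale1r.
- exists (maxn m n) => M; rewrite geq_max => /andP[/IHx xE /IHy yE].
  rewrite {1}xE {1}yE /sum3 -big_split; apply: eq_bigr => j _.
  rewrite -big_split; apply: eq_bigr => k _; rewrite -big_split; apply: eq_bigr => l _.
  by have := coordZD j k l 1 x y; rewrite !scale1r => ->.
- exists m => M /IH xE; rewrite {1}xE /sum3 scaler_sumr; apply: eq_bigr => j _.
  rewrite scaler_sumr; apply: eq_bigr => k _; rewrite scaler_sumr; apply: eq_bigr => l _.
  by have := coordZD j k l c x 0; rewrite coord0 !addr0 => ->.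
Qed.

Lemma phi_inj : injective phi.
Proof.
apply: raddf_inj => x x0; have [M /(_ M (leqnn M)) ->] := qplane_coord x.
rewrite /sum3; do 3![rewrite big1 // => ? _].
(* The coordinates of [x] depend on [phi x] only, so they vanish with it. *)
by rewrite /coord /dual x0 coef0 pairing0 mul0r scale0r.
Qed.

Lemma phi_image p : coord_ring act p <-> exists x, phi x = p.
Proof.
split=> [pR|[x <-] N].
  have mon N a : lspan (fun y => exists2 M, size M = N & y = Z M) a ->
      exists x, phi x = a%:P * 'X^N.
    elim=> {a} [|_ [M <- ->]|a b _ [x xa] _ [y yb]|c a _ [x xa]].
    - by exists 0; rewrite rmorph0 mul0r.
    - by exists (mono zq M); rewrite phi_mono.
    - by exists (x + y); rewrite rmorphD xa yb polyCD mulrDl.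
    - exists (c *: x); rewrite phiZ xa -mul_polyC mulrA -polyCM.
      by rewrite mulr_algl.
  rewrite -[p]coefK poly_def.
  (* A polynomial is the finite sum of its homogeneous terms, and each coefficient is a combination
     of words of the matching length by [hol_sectionP]. *)
  apply: (big_ind (fun p => exists x, phi x = p)) => [|a b [x <-] [y <-]|N _].
  - by exists 0; rewrite rmorph0.
  - by exists (x + y); rewrite rmorphD.
  - have /(hol_sectionP q_gt0 q_lt1 H)/mon[x xE] := pR N.
    by exists x; rewrite xE mul_polyC.
apply/(hol_sectionP q_gt0 q_lt1 H).
elim: (qplane_span x) => {x} [|_ [j [k [l ->]]]|x y _ IHx _ IHy|c x _ IH].
- by rewrite rmorph0 coef0; apply: lspan0.
- rewrite phi_mono3 coefCM coefXn; have [->|] := eqVneq N; last first.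
    by move=> _; rewrite mulr0; apply: lspan0.
  rewrite mulr1; apply: lspan_base.
  exists (nseq j (inord 0) ++ nseq k (inord 1) ++ nseq l (inord 2)).
    by rewrite !size_cat !size_nseq addnA.
  have monoX i n : mono (u r2) (nseq n i) = u r2 i ^+ n.
    by elim: n => [|n IH]; rewrite ?mono_nil //= mono_cons IH exprS.
  by rewrite /mono !big_cat /= -!/(mono _ _) !monoX mulrA.
- by rewrite rmorphD coefD; apply: lspanD.
- by rewrite phi_coefZ; apply: lspanZ.
Qed.

End Phi.
End CoordinateRing.

Theorem theorem4p2 (R : realType) (q : R) (q_gt0 : 0 < q) (q_lt1 : q < 1)
    (act : SUq3 q -> Uqsu3 q -> SUq3 q) (act_su3 : su3_action act) :
  exists phi : {rmorphism qplane q -> {poly SUq3 q}},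
    [/\ forall (c : R[i]) (x : qplane q), phi (c *: x) = c%:A *: phi x,
        injective phi
      & forall p : {poly SUq3 q}, coord_ring act p <-> exists x, phi x = p].
Proof.
have [phi [phiZ phiz]] := qplane_morphism q.
exists phi; split=> //.
  exact: (phi_inj q_gt0 q_lt1 act_su3 phiZ phiz).
exact: (phi_image q_gt0 q_lt1 act_su3 phiZ phiz).
Qed.
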